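(* Let $E$ be the limit set of a supercritical fractal percolation process in $[0,1]^d$ with parameters $b,p$, and let $m=pb^d$. Then almost surely, conditioned on nonextinction, there exists a sequence of subsets $D_n\subseteq E$ which are hyperplane diffuse and Ahlfors-regular with $\dim_H(D_n)$ increasing to $\log_bm$.
   Context: Fractal percolation with integer $b\ge2$ and $p\in(0,1)$: let $\Lambda=\{0,\dots,b-1\}^d$ and let $T$ be the Galton–Watson tree with alphabet $\Lambda$ and offspring distribution $W$ with $\mathbb{P}(W=B)=p^{|B|}(1-p)^{|\Lambda\setminus B|}$ ($B\subseteq\Lambda$): $T_0=\{\emptyset\}$, $T_n=\{aj:a\in T_{n-1},j\in W_a\}$ with independent copies $W_a$. The limit set is $E=\gamma_b(\partial T)$ where $\gamma_b(i)=\sum_{k\ge1}b^{-k}i_k$ and $\partial T$ is the set of infinite words all of whose prefixes lie in $T$ (equivalently, iteratively retain each $b$-adic subcube independently with probability $p$ and intersect). Supercritical means $m=pb^d>1$; nonextinction means $T_n\ne\emptyset$ for all $n$. A closed set $D$ is hyperplane diffuse if there are $\beta,\xi_0>0$ such that for all $\xi\in(0,\xi_0)$, $x\in D$ and affine hyperplanes $\mathcal{L}$, $D\cap B_\xi(x)\setminus\mathcal{L}^{(\beta\xi)}\ne\emptyset$ ($\mathcal{L}^{(\varepsilon)}$ the open $\varepsilon$-neighborhood). $D$ is Ahlfors-regular if it is the support of a measure $\mu$ with $c_1\rho^\delta\le\mu(B_\rho(x))\le c_2\rho^\delta$ for some $\delta,c_1,c_2>0$, all $\rho\in(0,1)$ and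 $x\in D$. *)

(* Defs.v *)
From HB Require Import structures.
From mathcomp Require Import all_boot all_order all_algebra.
From mathcomp Require Import all_classical all_reals all_analysis.
Set Implicit Arguments. Unset Strict Implicit. Unset Printing Implicit Defensive.
Import Order.TTheory GRing.Theory Num.Theory.
Import numFieldNormedType.Exports.
Local Open Scope classical_set_scope.
Local Open Scope ring_scope.

Definition Alph (b d : nat) : finType := {ffun 'I_d -> 'I_b}.

Fixpoint inT_from {b d : nat} (W : seq (Alph b d) -> {set Alph b d})
    (pre : seq (Alph b d)) (a : seq (Alph b d)) : Prop :=
  match a with
  | [::] => True
  | j :: a' => j \in W pre /\ inT_from W (rcons pre j) a'
  end.

Definition inT {b d : nat} (W : seq (Alph b d) -> {set Alph b d})
  (a : seq (Alph b d)) : Prop := inT_from W [::] a.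

Definition nonextinct {b d : nat} (W : seq (Alph b d) -> {set Alph b d}) : Prop :=
  forall n : nat, exists a : seq (Alph b d), size a = n /\ inT W a.

Definition boundaryT {b d : nat} (W : seq (Alph b d) -> {set Alph b d}) :
  set (nat -> Alph b d) :=
  [set i | forall n : nat, inT W (mkseq i n)].

(** gamma_b(i) = sum_{k>=1} b^{-k} i_k (coordinatewise); the letter i_k is
    [i k.-1] since infinite words are indexed from 0. *)
Definition gammab {R : realType} (b d : nat) (i : nat -> Alph b d) : 'rV[R]_d :=
  \row_(t < d) (limn (fun n => \sum_(0 <= k < n) (((i k t : nat)%:R : R) / (b%:R ^+ k.+1)))).

Definition limit_set {R : realType} (b d : nat)
  (W : seq (Alph b d) -> {set Alph b d}) : set 'rV[R]_d :=
  (@gammab R b d) @` boundaryT W.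

Definition edist {R : realType} {d : nat} (x y : 'rV[R]_d) : R :=
  Num.sqrt (\sum_(t < d) (x ord0 t - y ord0 t) ^+ 2).

Definition eball {R : realType} {d : nat} (x : 'rV[R]_d) (r : R) : set 'rV[R]_d :=
  [set y | edist x y < r].

Definition affine_hyperplane {R : realType} {d : nat} (L : set 'rV[R]_d) : Prop :=
  exists (a : 'rV[R]_d) (c : R), a != 0 /\
    L = [set x | \sum_(t < d) a ord0 t * x ord0 t = c].

Definition nbhd_of {R : realType} {d : nat} (L : set 'rV[R]_d) (eps : R) :
  set 'rV[R]_d := [set y | exists2 x, L x & edist y x < eps].

Definition hyperplane_diffuse {R : realType} {d : nat} (D : set 'rV[R]_d) : Prop :=
  closed D /\
  exists beta xi0 : R, 0 < beta /\ 0 < xi0 /\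
    forall xi : R, 0 < xi -> xi < xi0 ->
    forall x, D x -> forall L, affine_hyperplane L ->
      (D `&` eball x xi `\` nbhd_of L (beta * xi)) !=set0.

Definition Borel_Rd (R : realType) (d : nat) :=
  g_sigma_algebraType (@open 'rV[R]_d).

Definition msupport {R : realType} {d : nat}
  (mu : {measure set (Borel_Rd R d) -> \bar R}) : set 'rV[R]_d :=
  [set x | forall U : set 'rV[R]_d, open U -> U x -> (0 < mu U)%E].

Definition Ahlfors_regular {R : realType} {d : nat} (D : set 'rV[R]_d) : Prop :=
  exists (mu : {measure set (Borel_Rd R d) -> \bar R}) (delta c1 c2 : R),
    0 < delta /\ 0 < c1 /\ 0 < c2 /\ D = msupport mu /\
    forall rho : R, 0 < rho -> rho < 1 -> forall x, D x ->
      ((c1 * rho `^ delta)%:E <= mu (eball x rho))%E /\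
      (mu (eball x rho) <= (c2 * rho `^ delta)%:E)%E.

(** diameter (only used for nonempty bounded sets) *)
Definition ediam {R : realType} {d : nat} (U : set 'rV[R]_d) : R :=
  sup [set edist x y | x in U & y in U].

Definition diam_pow {R : realType} {d : nat} (U : set 'rV[R]_d) (s : R) : R :=
  if asbool (U = set0) then 0 else ediam U `^ s.

Definition delta_cover {R : realType} {d : nat} (A : set 'rV[R]_d) (delta : R)
  (U : nat -> set 'rV[R]_d) : Prop :=
  A `<=` \bigcup_i U i /\
  forall i x y, U i x -> U i y -> edist x y <= delta.

Definition hausdorff_pre {R : realType} {d : nat} (s delta : R)
  (A : set 'rV[R]_d) : \bar R :=
  ereal_inf [set (\sum_(0 <= i <oo) (diam_pow (U i) s)%:E)%E
            | U in delta_cover A delta].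

(** s-dimensional Hausdorff measure H^s(A) = lim_{delta -> 0} H^s_delta(A)
    (a nonincreasing limit, hence a supremum) *)
Definition hausdorff_measure {R : realType} {d : nat} (s : R)
  (A : set 'rV[R]_d) : \bar R :=
  ereal_sup [set hausdorff_pre s delta A | delta in [set delta : R | 0 < delta]].

Definition hausdorff_dim {R : realType} {d : nat} (A : set 'rV[R]_d) : \bar R :=
  ereal_inf [set s%:E | s in [set s : R | 0 <= s /\ hausdorff_measure s A = 0%E]].

(* Main.v *)
(* Write m = p b^d. A vertex v is declared good to depth k + 1 if all descendants of v in the
   next two generations are retained and each of the b^(2d) grandchildren has at least t
   retained descendants n generations further down that are good to depth k. The second moment
   method (Paley-Zygmund) bounds the probability of being good to depth k from below by a
   constant q > 0, uniformly in k, provided t <= m^n q / 2 and m^n q >= 1. Below a vertex which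
   is good to every depth, the tree contains a subtree in which every vertex has exactly
   M = b^(2d) t children, n + 2 generations down; its limit set is Ahlfors regular of dimension
   ln M / ((n + 2) ln b), which tends to log_b m as n grows. It is hyperplane diffuse because
   every vertex has children near all the corners of its cube, and a hyperplane cannot come
   close to both of the opposite corners at which its linear form is extremal.

   Almost surely on nonextinction there is such a vertex: the probability that generation j is
   inhabited but contains no vertex which is good to depth k is at most g^j(1 - q) - g^j(0) for
   the offspring generating function g, and this tends to 0 because g has only one fixed point
   in [0, 1). *)
Require Import Defs.
From HB Require Import structures.
From mathcomp Require Import all_boot all_order all_algebra.
From mathcomp Require Import all_classical all_reals all_analysis.
From mathcomp Require Import ring lra.
Import Order.TTheory GRing.Theory Num.Theory.
Import numFieldNormedType.Exports.
Set Implicit Arguments.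
Unset Strict Implicit.
Unset Printing Implicit Defensive.
Local Open Scope classical_set_scope.
Local Open Scope ring_scope.

(** * Second moments on finite random trees *)

(** Take means in the pointwise bound [X <= mu / 2 + X ^ 2 / (4 C mu) + C mu 1_(X >= mu / 2)], a
    completed square where [X >= mu / 2]. The first two terms contribute at most [3 mu / 4]. *)
Lemma paley_zygmund (R : realFieldType) (J : finType) (w X : J -> R) (mu C : R) :
  (forall j, 0 <= w j) -> \sum_j w j = 1 ->
  0 < mu -> 0 < C -> \sum_j w j * X j = mu -> \sum_j w j * X j ^+ 2 <= C * mu ^+ 2 ->
  (4 * C)^-1 <= \sum_j w j * (mu / 2 <= X j)%R%:R.
Proof.
move=> w0 w1 mu0 C0 EX EX2; set P := \sum_j _.
have C4 : 0 < 4 * C by rewrite mulr_gt0.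
have key : mu <= mu / 2 + C * mu ^+ 2 / (4 * C * mu) + C * mu * P.
  rewrite -{1}EX.
  apply: (@le_trans _ _ (\sum_j w j * (mu / 2 + X j ^+ 2 / (4 * C * mu) + C * mu * (mu / 2 <= X j)%R%:R))).
    apply: ler_sum => j _; apply: ler_wpM2l => //.
    case: (leP (mu / 2) (X j)) => [_|/ltW XL]; last first.
      rewrite mulr0 addr0 (le_trans XL)// lerDl divr_ge0 ?sqr_ge0// mulr_ge0// ltW//.
    rewrite mulr1 -subr_ge0.
    have -> : mu / 2 + X j ^+ 2 / (4 * C * mu) + C * mu - X j =
       mu / 2 + (X j - 2 * C * mu) ^+ 2 / (4 * C * mu).
      by field; rewrite !lt0r_neq0.
    by rewrite addr_ge0 ?divr_ge0 ?sqr_ge0// ?mulr_ge0// ltW.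
  under eq_bigr do rewrite !mulrDr.
  rewrite !big_split/= -mulr_suml w1 mul1r.
  apply: lerD; first apply: lerD => //.
    under eq_bigr do rewrite mulrA.
    by rewrite -mulr_suml ler_wpM2r// invr_ge0 mulr_ge0// ltW.
  under eq_bigr do rewrite mulrCA.
  by rewrite -mulr_sumr.
rewrite -[_^-1]mul1r ler_pdivrMr//.
have e : C * mu ^+ 2 / (4 * C * mu) = mu / 4 by field; rewrite !lt0r_neq0.
rewrite e in key.
have : mu * (1 / 4) <= mu * (C * P) by lra.
by rewrite ler_pM2l// => h; lra.
Qed.

(** * Moments on finite product spaces *)

Section product_weight.
Variables (R : realFieldType) (I J : finType) (w : J -> R).
Hypotheses (w0 : forall j, 0 <= w j) (w1 : \sum_j w j = 1).

Definition prodw (f : {ffun I -> J}) : R := \prod_i w (f i).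

Lemma prodw_ge0 f : 0 <= prodw f.
Proof. by apply: prodr_ge0. Qed.

Lemma prodw_prod (g : I -> J -> R) :
  \sum_f prodw f * \prod_i g i (f i) = \prod_i \sum_j w j * g i j.
Proof.
rewrite (bigA_distr_bigA (fun i j => w j * g i j)).
by apply: eq_bigr => f _; rewrite big_split.
Qed.

Lemma prodw_sum1 : \sum_f prodw f = 1.
Proof.
transitivity (\sum_f prodw f * \prod_(i : I) (fun _ _ => 1) i (f i)).
  by apply: eq_bigr => f _; rewrite big1 ?mulr1.
rewrite (prodw_prod (fun _ _ => 1)) big1// => i _.
by under eq_bigr do rewrite mulr1.
Qed.

Lemma prodw_coord (Y : J -> R) i :
  \sum_f prodw f * Y (f i) = \sum_j w j * Y j.
Proof.
pose g k j := if k == i then Y j else 1.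
transitivity (\sum_f prodw f * \prod_k g k (f k)).
  apply: eq_bigr => f _; rewrite (bigD1 i)//= big1 ?mulr1 /g ?eqxx// => k.
  by move=> /negPf->.
rewrite prodw_prod (bigD1 i)//= [X in _ * X]big1 ?mulr1 /g ?eqxx// => k /negPf->.
by under eq_bigr do rewrite mulr1.
Qed.

Lemma prodw_coord2 (Y : J -> R) i k : i != k ->
  \sum_f prodw f * (Y (f i) * Y (f k)) = (\sum_j w j * Y j) ^+ 2.
Proof.
move=> ik; have ki : k != i by rewrite eq_sym.
pose g l j := if l == i then Y j else if l == k then Y j else 1.
transitivity (\sum_f prodw f * \prod_l g l (f l)).
  apply: eq_bigr => f _; rewrite (bigD1 i)//= (bigD1 k)//= big1 ?mulr1.
    by rewrite /g eqxx (negPf ki) eqxx.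
  by rewrite /g => l /andP[/negPf-> /negPf->].
rewrite prodw_prod (bigD1 i)//= (bigD1 k)//= [X in _ * (_ * X)]big1 ?mulr1 /g.
  by rewrite eqxx (negPf ki) eqxx.
by move=> l /andP[/negPf-> /negPf->]; under eq_bigr do rewrite mulr1.
Qed.

Lemma prodw_sum (Y : J -> R) :
  \sum_f prodw f * (\sum_i Y (f i)) = #|I|%:R * \sum_j w j * Y j.
Proof.
under eq_bigr do rewrite mulr_sumr.
rewrite exchange_big/=; under eq_bigr do rewrite prodw_coord.
by rewrite sumr_const mulr_natl.
Qed.

(** In the expanded square the diagonal gives the mean of [Y ^+ 2], and by independence each
    off-diagonal term is the squared mean; diagonal squares are added to complete the count. *)
Lemma prodw_sum_sq (Y : J -> R) :
  \sum_f prodw f * (\sum_i Y (f i)) ^+ 2 <=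
  #|I|%:R * (\sum_j w j * Y j ^+ 2) + #|I|%:R ^+ 2 * (\sum_j w j * Y j) ^+ 2.
Proof.
have -> : \sum_f prodw f * (\sum_i Y (f i)) ^+ 2 =
    \sum_i \sum_k \sum_f prodw f * (Y (f i) * Y (f k)).
  under eq_bigr do rewrite expr2 mulr_suml mulr_sumr.
  rewrite exchange_big/=; apply: eq_bigr => i _.
  under eq_bigr do rewrite mulr_sumr mulr_sumr.
  by rewrite exchange_big.
rewrite (mulr_natl _ #|I|) -sumr_const expr2 -mulrA (mulr_natl _ #|I|) -sumr_const -big_split/=.
apply: ler_sum => i _; rewrite (bigD1 i)//=; apply: lerD.
  by rewrite (prodw_coord (fun j => Y j * Y j) i).
apply: (@le_trans _ _ (\sum_(k | k != i) (\sum_j w j * Y j) ^+ 2)).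
  by apply: ler_sum => k ki; rewrite prodw_coord2// eq_sym.
rewrite (mulr_natl _ #|I|) -sumr_const [leRHS](bigD1 i)//= lerDr.
exact: sqr_ge0.
Qed.

End product_weight.

(* A tree of height h records a retention bit and a subtree for every letter. Deleted children
   have a subtree too, so that the coordinates are independent and identically distributed. *)
Fixpoint Conf (L : finType) (h : nat) : finType :=
  if h is h'.+1 then {ffun L -> bool * Conf L h'} else unit.

(** * Moments and good roots in random trees of finite height *)

Section random_tree.
Variables (R : realFieldType) (L : finType) (p : R).
Hypotheses (p0 : 0 < p) (p1 : p < 1).

Fixpoint wt (h : nat) : Conf L h -> R :=
  if h is h'.+1
  then prodw (fun y : bool * Conf L h' => (if y.1 then p else 1 - p) * wt y.2)
  else fun=> 1.

Definition wexp h (X : Conf L h -> R) : R := \sum_x wt x * X x.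
Definition wprob h (Q : pred (Conf L h)) : R := wexp (fun x => (Q x)%:R).

Definition bw h (y : bool * Conf L h) : R := (if y.1 then p else 1 - p) * wt y.2.

Lemma sum_bw h (X : bool * Conf L h -> R) :
  \sum_y bw y * X y =
  p * wexp (fun x => X (true, x)) + (1 - p) * wexp (fun x => X (false, x)).
Proof.
transitivity (\sum_a \sum_x bw (a, x) * X (a, x)).
  by rewrite pair_bigA; apply: eq_bigr => -[].
rewrite big_bool/=.
by rewrite /wexp !mulr_sumr; congr (_ + _); apply: eq_bigr => x _; rewrite mulrA.
Qed.

Lemma wt_ge0 h (x : Conf L h) : 0 <= wt x.
Proof.
elim: h x => [|h IH] x /=; first exact: ler01.
apply: prodw_ge0 => -[a y] /=; rewrite mulr_ge0//.
by case: a; rewrite ?subr_ge0 ltW.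
Qed.

Lemma wt_sum1 h : \sum_(x : Conf L h) wt x = 1.
Proof.
elim: h => [|h IH] /=; first by rewrite big_const card_unit /= addr0.
apply: prodw_sum1; have := @sum_bw h (fun=> 1).
under eq_bigr do rewrite mulr1.
move=> ->; rewrite /wexp; under eq_bigr do rewrite mulr1.
by rewrite IH; ring.
Qed.

Lemma bw_sum1 h : \sum_(y : bool * Conf L h) bw y = 1.
Proof.
have := @sum_bw h (fun=> 1); under eq_bigr do rewrite mulr1.
move=> ->; rewrite /wexp; under eq_bigr do rewrite mulr1.
by rewrite wt_sum1; ring.
Qed.

Lemma wprob_ge0 h (Q : pred (Conf L h)) : 0 <= wprob Q.
Proof. by apply: sumr_ge0 => x _; rewrite mulr_ge0 ?wt_ge0. Qed.

Lemma le_wprob h (Q Q' : pred (Conf L h)) : (forall x, Q x -> Q' x) -> wprob Q <= wprob Q'.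
Proof.
move=> QQ; apply: ler_sum => x _; rewrite ler_wpM2l ?wt_ge0// ler_nat.
by case: (Q x) (QQ x) => // ->.
Qed.

Lemma wprobC h (Q : pred (Conf L h)) : wprob (fun x => ~~ Q x) = 1 - wprob Q.
Proof.
rewrite /wprob /wexp -[X in X - _](wt_sum1 h) -sumrB; apply: eq_bigr => x _.
by case: (Q x) => /=; rewrite ?mulr0 ?mulr1 ?subrr ?subr0.
Qed.

Lemma wprob_diff h (Q Q' : pred (Conf L h)) : (forall x, Q' x -> Q x) ->
  wprob (fun x => Q x && ~~ Q' x) = wprob Q - wprob Q'.
Proof.
move=> QQ; rewrite /wprob /wexp -sumrB; apply: eq_bigr => x _; rewrite -mulrBr.
by case: (Q' x) (QQ x) => [->//|_]; rewrite ?subrr// subr0 andbT.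
Qed.

Definition allk h (Q : pred (Conf L h)) : pred (Conf L h.+1) :=
  fun f => [forall i, (f i).1 && Q (f i).2].

Lemma natr_forall (P : pred L) : [forall i, P i]%:R = \prod_i (P i)%:R :> R.
Proof.
case: forallP => [H|/forallP]; first by rewrite big1// => i _; rewrite H.
rewrite negb_forall => /existsP[i /negPf Pi].
by rewrite (bigD1 i)//= Pi mul0r.
Qed.

Lemma wprob_forall h (Q : pred (bool * Conf L h)) :
  wprob (fun f : Conf L h.+1 => [forall i, Q (f i)]) = (\sum_y bw y * (Q y)%:R) ^+ #|L|.
Proof.
rewrite /wprob /wexp; under eq_bigr do rewrite natr_forall.
rewrite (@prodw_prod R L _ (@bw h) (fun _ y => (Q y)%:R)).
by rewrite prodr_const.
Qed.

Lemma wexp0 h : wexp (fun _ : Conf L h => 0) = 0.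
Proof. by rewrite /wexp big1// => x _; rewrite mulr0. Qed.

Lemma wexp1 h : wexp (fun _ : Conf L h => 1) = 1.
Proof. by rewrite /wexp -[RHS](wt_sum1 h); apply: eq_bigr => x _; rewrite mulr1. Qed.

Lemma wprob_allk h (Q : pred (Conf L h)) : wprob (allk Q) = (p * wprob Q) ^+ #|L|.
Proof.
rewrite (@wprob_forall h (fun y => y.1 && Q y.2)); congr (_ ^+ _).
by rewrite sum_bw/= wexp0 mulr0 addr0.
Qed.

(** Deleted children impose no condition, so this holds vacuously when generation [n] is empty; for
    constantly false [Q] it is extinction by generation [n]. *)
Fixpoint all_gen n h (Q : pred (Conf L h)) : pred (Conf L (n + h)) :=
  if n is n'.+1 return pred (Conf L (n + h))
  then fun f => [forall i, (f i).1 ==> @all_gen n' h Q (f i).2] else Q.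
Arguments all_gen n {h} Q _.

(** Generating function of the number of retained children, which is binomial with parameters [#|L|]
    and [p]. *)
Definition genf (x : R) : R := (1 - p + p * x) ^+ #|L|.

Lemma wprob_all_gen n h (Q : pred (Conf L h)) : wprob (all_gen n Q) = iter n genf (wprob Q).
Proof.
elim: n => [//|n IH] /=.
rewrite (@wprob_forall (n + h) (fun y => y.1 ==> all_gen n Q y.2)); congr (_ ^+ _).
by rewrite sum_bw/= wexp1 mulr1 -[wexp _]/(wprob (all_gen n Q)) IH addrC.
Qed.

Lemma all_gen_mono n h (Q Q' : pred (Conf L h)) :
  (forall x, Q x -> Q' x) -> forall x, all_gen n Q x -> all_gen n Q' x.
Proof.
move=> QQ; elim: n => [//|n IH] f /= /forallP H; apply/forallP => i.
by apply/implyP => fi; apply: IH; exact: (implyP (H i)).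
Qed.

Fixpoint cnt n h (Q : pred (Conf L h)) : Conf L (n + h) -> nat :=
  if n is n'.+1 return Conf L (n + h) -> nat
  then fun f => (\sum_i if (f i).1 then @cnt n' h Q (f i).2 else 0)%N
  else fun x => Q x.
Arguments cnt n {h} Q _.

Let m := p * #|L|%:R.

Lemma wexp_cnt n h (Q : pred (Conf L h)) : wexp (fun x => (cnt n Q x)%:R) = m ^+ n * wprob Q.
Proof.
elim: n => [|n IH]; first by rewrite mul1r.
rewrite /wexp /=; under eq_bigr do rewrite natr_sum.
rewrite (@prodw_sum R L _ (@bw (n + h)) (@bw_sum1 _)
  (fun y => (if y.1 then cnt n Q y.2 else 0%N)%:R)) sum_bw/= wexp0 IH exprS /m.
ring.
Qed.

(** With [x] the mean in generation [n], one more generation turns the bound [x + K x ^ 2] into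
    [m x + m K x ^ 2 + m ^ 2 x ^ 2]; for [K = m / (m - 1)] this equals [m x + K m ^ 2 x ^ 2]. *)
Lemma wexp_cnt_sq n h (Q : pred (Conf L h)) : 1 < m ->
  wexp (fun x => (cnt n Q x)%:R ^+ 2) <=
  m ^+ n * wprob Q + m / (m - 1) * (m ^+ n * wprob Q) ^+ 2.
Proof.
move=> m1; have m10 : m - 1 != 0 by rewrite subr_eq0 gt_eqF.
have k0 : 0 <= m / (m - 1) by rewrite divr_ge0// ?subr_ge0 ltW// (lt_trans _ m1).
elim: n => [|n IH].
  rewrite !mul1r /= (@le_trans _ _ (wprob Q))//; last by rewrite lerDl mulr_ge0// sqr_ge0.
  apply: ler_sum => x _; rewrite ler_wpM2l ?wt_ge0//.
  by case: (Q x); rewrite ?expr0n ?expr1n.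
rewrite /wexp /=; under eq_bigr do rewrite natr_sum.
apply: le_trans; first exact: (@prodw_sum_sq R L _ (@bw (n + h)) (@bw_sum1 _)
  (fun y => (if y.1 then cnt n Q y.2 else 0%N)%:R)).
rewrite !sum_bw/= expr0n/= wexp0 wexp_cnt mulr0 !addr0.
apply: le_trans.
  apply: lerD; last exact: lexx.
  rewrite mulrA (mulrC _ p); apply: ler_wpM2l IH.
  by rewrite mulr_ge0// ltW.
rewrite -/m le_eqVlt; apply/orP; left; apply/eqP; rewrite (exprS m n).
have -> : #|L|%:R ^+ 2 * (p * (m ^+ n * wprob Q)) ^+ 2 = (m * (m ^+ n * wprob Q)) ^+ 2.
  by rewrite /m; ring.
by move: m10; move: (m ^+ n) m => y x ?; field.
Qed.

Definition pz_const : R := (4 * (1 + m / (m - 1)))^-1.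

(** A mean of at least 1 is at most its square, so the second moment is at most [1 + m / (m - 1)]
    times the squared mean. *)
Lemma wprob_cnt n h (Q : pred (Conf L h)) : 1 < m -> 1 <= m ^+ n * wprob Q ->
  pz_const <= wprob (fun x => m ^+ n * wprob Q / 2 <= (cnt n Q x)%:R).
Proof.
move=> m1 h1; have k0 : 0 <= m / (m - 1).
  by rewrite divr_ge0// ?subr_ge0 ltW// (lt_trans _ m1).
apply: (@paley_zygmund R _ (@wt (n + h)) (fun x => (cnt n Q x)%:R)) => //.
- by move=> x; apply: wt_ge0.
- exact: wt_sum1.
- exact: lt_le_trans h1.
- by rewrite ltr_pwDl.
- exact: wexp_cnt.
apply: le_trans (wexp_cnt_sq _ _ m1) _.
rewrite mulrDl mul1r lerD// -[leLHS]mulr1 expr2 ler_pM//.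
by apply: le_trans h1.
Qed.

Lemma pz_const_gt0 : 1 < m -> 0 < pz_const.
Proof.
move=> m1; rewrite invr_gt0 mulr_gt0// ltr_pwDl//.
by rewrite divr_ge0// ?subr_ge0 ltW// (lt_trans _ m1).
Qed.

Lemma pz_const_le1 : 1 < m -> pz_const <= 1.
Proof.
move=> m1; rewrite invf_le1.
  have : 0 <= m / (m - 1) by rewrite divr_ge0// ?subr_ge0 ltW// (lt_trans _ m1).
  lra.
by rewrite mulr_gt0// ltr_pwDl// divr_ge0// ?subr_ge0 ltW// (lt_trans _ m1).
Qed.

Fixpoint good_height n k : nat :=
  if k is k'.+1 then (n + good_height n k').+2 else 0.

Fixpoint goodc n t k : pred (Conf L (good_height n k)) :=
  if k is k'.+1 return pred (Conf L (good_height n k))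
  then allk (allk (fun x => t <= cnt n (@goodc n t k') x)%N) else xpredT.
Arguments goodc : clear implicits.

(** Probability that two full generations are retained and each grandchild independently succeeds
    with probability [pz_const]. It involves neither [n], [t] nor the depth, so [n] can be chosen
    large afterwards. *)
Definition qstar : R := (p * (p * pz_const) ^+ #|L|) ^+ #|L|.

Lemma qstar_gt0 : 1 < m -> 0 < qstar.
Proof.
by move=> m1; rewrite exprn_gt0// mulr_gt0// exprn_gt0// mulr_gt0// pz_const_gt0.
Qed.

(** Induction on the depth: the mean number of good descendants of a grandchild is at least
    [m ^+ n * qstar], so [t] lies below half of it and the second moment bound applies; the two full
    generations then reproduce [qstar]. *)
Lemma wprob_goodc n t k : 1 < m -> 1 <= m ^+ n * qstar -> t%:R <= m ^+ n * qstar / 2 ->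
  qstar <= wprob (goodc n t k).
Proof.
move=> m1 h1 ht; have m0 : 0 <= m by rewrite ltW// (lt_trans _ m1).
have z0 := ltW (pz_const_gt0 m1); have p0' := ltW p0.
elim: k => [|k IH].
  rewrite [leRHS](_ : _ = 1); last exact: wexp1.
  rewrite exprn_ile1// ?mulr_ge0// ?exprn_ge0// ?mulr_ge0//.
  rewrite mulr_ile1 ?exprn_ge0// ?mulr_ge0// ?(ltW p1)//.
  by rewrite exprn_ile1// ?mulr_ge0// mulr_ile1// ?(ltW p1)// pz_const_le1.
rewrite /= !wprob_allk /qstar.
rewrite lerXn2r ?nnegrE// ?mulr_ge0// ?exprn_ge0// ?mulr_ge0// ?wprob_ge0//.
rewrite ler_wpM2l// lerXn2r ?nnegrE// ?mulr_ge0// ?wprob_ge0// ler_wpM2l//.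
have IH' : m ^+ n * qstar <= m ^+ n * wprob (goodc n t k) by rewrite ler_wpM2l// exprn_ge0.
apply: le_trans (wprob_cnt m1 (le_trans h1 IH')) _.
apply: le_wprob => x hx; rewrite -(ler_nat R).
by apply: le_trans ht _; apply: le_trans _ hx; rewrite ler_wpM2r.
Qed.

End random_tree.

Arguments all_gen {L} n {h} Q _.
Arguments cnt {L} n {h} Q _.
Arguments goodc : clear implicits.

(** * The offspring generating function *)

Section generating_function.
Variables (R : realType) (L : finType) (p : R).
Hypotheses (p0 : 0 < p) (p1 : p < 1) (m1 : 1 < p * #|L|%:R).

Let g := genf L p.

Lemma genf_base (x : R) : 1 - p + p * x = 1 - p * (1 - x). Proof. ring. Qed.

Lemma genf_bounds (x : R) : 0 <= x <= 1 -> 0 <= 1 - p + p * x <= 1.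
Proof.
move=> /andP[x0 x1]; have := mulr_ge0 (ltW p0) x0.
have : p * x <= p by rewrite ler_piMr// ltW.
move=> ? ?; apply/andP; split; have := p1; lra.
Qed.

Lemma genf_itv (x : R) : 0 <= x <= 1 -> 0 <= g x <= 1.
Proof.
move=> /genf_bounds /andP[h0 h1].
by rewrite /g /genf exprn_ge0//= exprn_ile1.
Qed.

Lemma genf_mono (x y : R) : 0 <= x -> x <= y -> y <= 1 -> g x <= g y.
Proof.
move=> x0 xy y1; rewrite /g /genf lerXn2r ?nnegrE//; last by rewrite lerD2l ler_wpM2l// ltW.
  by have /andP[] : 0 <= 1 - p + p * x <= 1 by apply: genf_bounds; rewrite x0 (le_trans xy).
by have /andP[] : 0 <= 1 - p + p * y <= 1 by apply: genf_bounds; rewrite y1 (le_trans x0).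
Qed.

Lemma iter_genf_itv n (x : R) : 0 <= x <= 1 -> 0 <= iter n g x <= 1.
Proof. by move=> h; elim: n => //= n; apply: genf_itv. Qed.

Lemma iter_genf_mono n (x y : R) : 0 <= x -> x <= y -> y <= 1 -> iter n g x <= iter n g y.
Proof.
move=> x0 xy y1; elim: n => //= n IH.
have /andP[a0 _] : 0 <= iter n g x <= 1 by apply: iter_genf_itv; rewrite x0 (le_trans xy).
have /andP[_ b1] : 0 <= iter n g y <= 1 by apply: iter_genf_itv; rewrite y1 (le_trans x0).
exact: genf_mono.
Qed.

(* (1 - y)^K <= 1 / (1 + K y), since (1 - y)(1 + y) <= 1 and 1 + K y <= (1 + y)^K. *)
Lemma exprn_1B_le (K : nat) (y : R) : 0 <= y <= 1 -> (1 - y) ^+ K * (1 + K%:R * y) <= 1.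
Proof.
move=> /andP[y0 y1]; elim: K => [|K IH]; first by rewrite mul0r addr0 mulr1.
apply: le_trans IH; rewrite exprSr -mulrA ler_wpM2l// ?exprn_ge0 ?subr_ge0//.
rewrite -natr1; have : 0 <= (K%:R : R) by []. move: (K%:R : R) => k; nra.
Qed.

(** [exprn_1B_le] gives [g x <= 1 / (1 + m (1 - x))], which is at most [x] because
    [(m x - 1) (1 - x) >= 0]. *)
Lemma genf_le (x : R) : (p * #|L|%:R)^-1 <= x <= 1 -> g x <= x.
Proof.
have mgt1 := m1; set m := p * _ in mgt1 *; move=> /andP[xm x1].
have m0 : 0 < m by rewrite (lt_trans _ mgt1).
have mx : 1 <= m * x by rewrite -ler_pdivrMl// mulr1.
have x0 : 0 <= x by rewrite (le_trans _ xm)// invr_ge0 ltW.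
have hy : 0 <= p * (1 - x) <= 1.
  by rewrite mulr_ge0 ?subr_ge0 ?(ltW p0)//= mulr_ile1 ?subr_ge0 ?(ltW p0) ?(ltW p1)// gerBl.
have := exprn_1B_le #|L| hy; rewrite -genf_base -/(genf L p x) -/g.
have -> : #|L|%:R * (p * (1 - x)) = m * (1 - x) by rewrite /m; ring.
have mx0 : 0 <= m * (1 - x) by rewrite mulr_ge0 ?(ltW m0)// subr_ge0.
have mpos : 0 < 1 + m * (1 - x) by rewrite ltr_pwDl.
move=> h; rewrite -(ler_pM2r mpos); apply: le_trans h _.
have : 0 <= (m * x - 1) * (1 - x) by rewrite mulr_ge0// subr_ge0.
nra.
Qed.

Lemma card_letters_ge2 : (1 < #|L|)%N.
Proof.
rewrite ltnNge; apply/negP => h.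
have : p * #|L|%:R <= 1 by rewrite mulr_ile1 ?(ltW p0) ?(ltW p1)// (ler_nat R _ 1).
by rewrite leNgt m1.
Qed.

(* For a fixed point z < 1, dividing 1 - g(z) = 1 - z by 1 - (1 - p + p z) shows that
   sum_(i < K) (1 - p + p z)^i = 1/p, and the left side is strictly increasing in z. *)
Lemma genf_fixed_unique (x y : R) : 0 <= x -> x <= y -> y < 1 -> g x = x -> g y = y -> x = y.
Proof.
move=> x0 xy y1 gx gy; apply/eqP; rewrite eq_le xy/= leNgt; apply/negP => xlty.
have S z : z < 1 -> g z = z -> p * \sum_(i < #|L|) (1 - p + p * z) ^+ i = 1.
  move=> z1 gz; have := subrX1 (1 - p + p * z) #|L|.
  rewrite -/(genf L p z) -/g gz => h.
  have : (z - 1) * (p * \sum_(i < #|L|) (1 - p + p * z) ^+ i - 1) = 0.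
    move: h; set s := \sum_(i < _) _ => h.
    have -> : (z - 1) * (p * s - 1) = (1 - p + p * z - 1) * s - (z - 1) by ring.
    by rewrite -h subrr.
  by move/eqP; rewrite mulf_eq0 !subr_eq0 lt_eqF//= => /eqP.
have := S _ (lt_trans xlty y1) gx; rewrite -[RHS](S _ y1 gy).
move/(mulfI (lt0r_neq0 p0))/eqP; rewrite lt_eqF//.
have zw : 1 - p + p * x < 1 - p + p * y by rewrite ltrD2l ltr_pM2l.
have /andP[z0 _] : 0 <= 1 - p + p * x <= 1.
  by apply: genf_bounds; rewrite x0/= (le_trans xy)// ltW.
have w0 := le_trans z0 (ltW zw).
(* With at least two letters the sum has a term of exponent 1, and this one increases strictly. *)
rewrite (bigD1 (Ordinal card_letters_ge2))//= [ltRHS](bigD1 (Ordinal card_letters_ge2))//=.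
rewrite ltr_leD//; apply: ler_sum => i _.
by rewrite lerXn2r ?nnegrE// ltW.
Qed.

Lemma genf_lim_fixed (u : nat -> R) (l : R) : (forall n, u n.+1 = g (u n)) ->
  u @ \oo --> l -> g l = l.
Proof.
move=> uS ul.
have h1 : [sequence u n.+1]_n @ \oo --> l by rewrite cvg_shiftS.
have h2 : (fun n => g (u n)) @ \oo --> g l.
  rewrite /g /genf; apply: (@continuous_cvg _ _ _ _ _ _ (fun x : R => x ^+ #|L|)).
    exact: exprn_continuous.
  by apply: cvgD; [exact: cvg_cst|apply: cvgM => //; exact: cvg_cst].
have e : [sequence u n.+1]_n = (fun n => g (u n)) by apply/funext => n /=; rewrite uS.
by rewrite e in h1; exact: (cvg_unique _ h2 h1).
Qed.

Lemma iter_genf_gap (x : R) : 0 <= x -> x < 1 ->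
  (fun n => iter n g x - iter n g 0) @ \oo --> (0 : R).
Proof.
(* At [y] the function [g] is below the identity, so the iterates from [y] decrease, while those
   from 0 increase. Both limits are fixed points below 1, hence equal, and the gap started at [x] is
   squeezed. *)
move=> x0 x1; pose y := Num.max x (p * #|L|%:R)^-1.
have m0 : 0 < p * #|L|%:R by rewrite (lt_trans _ m1).
have xy : x <= y by rewrite le_max lexx.
have my : (p * #|L|%:R)^-1 <= y by rewrite le_max lexx orbT.
have y0 := le_trans x0 xy.
have y1 : y < 1 by rewrite gt_max x1 invf_lt1.
have y01 : 0 <= y <= 1 by rewrite y0 ltW.
have z01 : 0 <= (0 : R) <= 1 by rewrite lexx ler01.
have Iu n : iter n.+1 g y <= iter n g y.
  rewrite iterSr; apply: iter_genf_mono; rewrite ?(ltW y1)//.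
    by have /andP[] := genf_itv y01.
  by apply: genf_le; rewrite my ltW.
have Iv n : iter n g 0 <= iter n.+1 g 0.
  have /andP[? ?] := genf_itv z01.
  by rewrite iterSr; apply: iter_genf_mono.
have du : {homo (fun n => iter n g y) : n k / (n <= k)%N >-> k <= n}.
  by apply/nonincreasing_seqP.
have dv : {homo (fun n => iter n g 0) : n k / (n <= k)%N >-> n <= k}.
  by apply/nondecreasing_seqP.
have cu : cvgn (fun n => iter n g y).
  apply: nonincreasing_is_cvgn => //; exists 0 => _ [n _ <-].
  by have /andP[] := iter_genf_itv n y01.
have cv : cvgn (fun n => iter n g 0).
  apply: nondecreasing_is_cvgn => //; exists 1 => _ [n _ <-].
  by have /andP[] := iter_genf_itv n z01.
set a := limn (fun n => iter n g y) in cu; set c := limn (fun n => iter n g 0) in cv.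
have ca : c = a.
  apply: genf_fixed_unique.
  - by apply: limr_ge => //; apply: nearW => n; have /andP[] := iter_genf_itv n z01.
  - by apply: ler_lim => //; apply: nearW => n; apply: iter_genf_mono; rewrite ?(ltW y1).
  - exact: le_lt_trans (nonincreasing_cvgn_ge du cu 0) y1.
  - exact: (@genf_lim_fixed (fun n => iter n g 0) _ (fun=> erefl) cv).
  - exact: (@genf_lim_fixed (fun n => iter n g y) _ (fun=> erefl) cu).
have lim0 : (fun n => iter n g y - iter n g 0) @ \oo --> (0 : R).
  have := cvgB cu cv; rewrite -/a -/c ca subrr => H; exact: H.
apply: (squeeze_cvgr _ _ lim0); last exact: cvg_cst.
apply: nearW => n; rewrite subr_ge0 iter_genf_mono//= ?(ltW x1)//.
by rewrite lerD2r iter_genf_mono// ltW.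
Qed.

End generating_function.

(** * Good vertices exist almost surely *)

Section tree_restriction.
Variable L : finType.
Implicit Types (W : seq L -> {set L}) (v u : seq L).

Fixpoint res W h v : Conf L h :=
  if h is h'.+1 return Conf L h
  then [ffun i => (i \in W v, res W h' (rcons v i))] else tt.

(** The words of length less than [h], that is, the vertices below [v] whose offspring sets
    [res W h v] records. *)
Fixpoint words h : seq (seq L) :=
  if h is h'.+1 then [::] :: [seq i :: u | i <- enum L, u <- words h'] else [::].

Fixpoint offspring h : Conf L h -> seq L -> {set L} :=
  if h is h'.+1 return Conf L h -> seq L -> {set L}
  then fun x u => if u is i :: u' then @offspring h' (x i).2 u' else finset (fun i => (x i).1)
  else fun _ _ => finset.set0.

Lemma words_uniq h : uniq (words h).
Proof.
elim: h => //= h IH; apply/andP; split.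
  by apply/allpairsP => -[[i u]] /= [_ _].
apply: allpairs_uniq; rewrite ?enum_uniq//.
by move=> [i u] [j w] _ _ /= [-> ->].
Qed.

(** Turns a prescribed finite tree into a cylinder event for finitely many offspring sets, to which
    the law of [W] applies. *)
Lemma res_eqP W h v (x : Conf L h) :
  res W h v = x <-> forall u, u \in words h -> W (v ++ u) = offspring x u.
Proof.
elim: h v x => [|h IH] v x /=; first by case: x.
split=> [<- u|H].
  rewrite inE => /orP[/eqP->|/allpairsP[[i w]] /= [_ hw ->]].
    by rewrite cats0; apply/setP => i; rewrite inE ffunE.
  rewrite ffunE/= -cat_rcons; exact: (IH (rcons v i) _).1.
apply/ffunP => i; rewrite ffunE; apply/eqP; rewrite -pair_eqE; apply/andP; split.
  by have := H [::] (mem_head _ _); rewrite cats0 => ->; rewrite /= inE.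
apply/eqP/IH => u hu; rewrite cat_rcons (H (i :: u))// inE; apply/orP; right.
by apply/allpairsP; exists (i, u); rewrite mem_enum.
Qed.

Lemma prod_offspring (R : realFieldType) (p : R) h (x : Conf L h) :
  \prod_(u <- words h) (p ^+ #|offspring x u| * (1 - p) ^+ #|~: offspring x u|) =
  wt p x.
Proof.
elim: h x => [|h IH] x /=; first by rewrite big_nil.
rewrite big_cons/= big_allpairs_dep/= big_enum/= /prodw [in RHS]big_split/=.
under [X in _ * X]eq_bigr do rewrite IH.
rewrite -(prodr_const _ p) -(prodr_const _ (1 - p)).
rewrite [in RHS](bigID (mem (finset (fun i => (x i).1))))/=.
apply: (congr2 *%R) => //; apply: (congr2 *%R).
  by apply: eq_big => i; rewrite inE// => ->.
by apply: eq_big => i; rewrite !inE// => /negPf->.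
Qed.

End tree_restriction.

(** * The law of the restricted tree *)

Section restriction_law.
Variables (R : realType) (dO : measure_display) (Omega : measurableType dO).
Variables (P : probability Omega R) (L : finType) (p : R).
Variable W : seq L -> Omega -> {set L}.
Hypotheses (p0 : 0 < p) (p1 : p < 1).
Hypothesis mW : forall a B, measurable [set w : Omega | W a w = B].
Hypothesis PW : forall (s : seq (seq L)) (B : seq L -> {set L}), uniq s ->
  P [set w : Omega | forall a, a \in s -> W a w = B a] =
  (\prod_(a <- s) (p ^+ #|B a| * (1 - p) ^+ #|~: B a|))%:E.

Let Wt w : seq L -> {set L} := fun a => W a w.

Lemma res_event h v (x : Conf L h) :
  [set w | res (Wt w) h v = x] =
  [set w | forall a, a \in map (cat v) (words L h) -> W a w = offspring x (drop (size v) a)].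
Proof.
apply/seteqP; split => w /=.
  by move=> /res_eqP H _ /mapP[u hu ->]; rewrite drop_size_cat//; exact: H.
move=> H; apply/res_eqP => u hu; rewrite /Wt H ?drop_size_cat//.
by apply/mapP; exists u.
Qed.

Lemma measurable_res h v (x : Conf L h) : measurable [set w | res (Wt w) h v = x].
Proof.
rewrite res_event; elim: (map _ _) => [|a s IH].
  by rewrite [X in measurable X](_ : _ = setT)//; apply/seteqP; split.
rewrite [X in measurable X](_ : _ = [set w | W a w = offspring x (drop (size v) a)] `&`
  [set w | forall a, a \in s -> W a w = offspring x (drop (size v) a)]).
  exact: measurableI.
apply/seteqP; split => w /=.
  by move=> H; split=> [|c cs]; apply: H; rewrite inE ?eqxx// cs orbT.
by move=> [H1 H2] c; rewrite inE => /orP[/eqP->//|]; exact: H2.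
Qed.

Lemma prob_res h v (x : Conf L h) : P [set w | res (Wt w) h v = x] = (wt p x)%:E.
Proof.
rewrite res_event PW; last first.
  rewrite map_inj_uniq ?words_uniq// => a c /eqP.
  by rewrite eqseq_cat// eqxx => /eqP.
rewrite big_map -prod_offspring; congr (_%:E).
by apply: eq_bigr => u _; rewrite drop_size_cat.
Qed.

Lemma prob_res_mem h v (s : seq (Conf L h)) :
  measurable [set w | res (Wt w) h v \in s] /\
  (P [set w | res (Wt w) h v \in s] <= (\sum_(x <- s) wt p x)%:E)%E.
Proof.
elim: s => [|x s [mS IH]].
  rewrite [X in measurable X](_ : _ = set0)//; last by apply/seteqP; split.
  rewrite [X in P X](_ : _ = set0)//; last by apply/seteqP; split.
  by rewrite measure0 big_nil.
have e : [set w | res (Wt w) h v \in x :: s] =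
    [set w | res (Wt w) h v = x] `|` [set w | res (Wt w) h v \in s].
  apply/seteqP; split => w /=.
    by rewrite inE => /orP[/eqP|]; [left|right].
  by rewrite inE => -[->|->]; rewrite ?eqxx ?orbT.
have mx := @measurable_res h v x.
rewrite e; split; first exact: measurableU.
apply: le_trans (measureU2 _ mx mS) _.
by rewrite big_cons EFinD -(prob_res v x); exact: leeD.
Qed.

Lemma prob_res_pred h v (Q : pred (Conf L h)) :
  measurable [set w | Q (res (Wt w) h v)] /\
  (P [set w | Q (res (Wt w) h v)] <= (wprob p Q)%:E)%E.
Proof.
have [mS] := @prob_res_mem h v (enum Q).
rewrite [X in measurable X](_ : _ = [set w | Q (res (Wt w) h v)]) in mS *; last first.
  by apply/seteqP; split => w /=; rewrite mem_enum.
move=> H; split => //.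
rewrite [X in P X](_ : _ = [set w | res (Wt w) h v \in enum Q]); last first.
  by apply/seteqP; split => w /=; rewrite mem_enum.
apply: le_trans H _; rewrite lee_fin big_enum/= /wprob /wexp [leRHS](bigID Q)/=.
rewrite [X in _ + X]big1 ?addr0 => [|x /negPf->]; last by rewrite mulr0.
by apply: ler_sum => x; rewrite unfold_in => ->; rewrite mulr1.
Qed.

End restriction_law.

(** * Good vertices of a fixed tree *)

Section good_vertices.
Variables (L : finType) (W : seq L -> {set L}).
Implicit Types (v u : seq L) (Q : pred (seq L)).

Fixpoint cntW n Q v : nat :=
  if n is n'.+1 then (\sum_i if i \in W v then cntW n' Q (rcons v i) else 0)%N
  else Q v.

Definition allW Q : pred (seq L) := fun v => [forall i, (i \in W v) && Q (rcons v i)].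

(** The counterpart of [goodc] read off [W] itself; without the height index different depths become
    comparable. *)
Fixpoint goodW n t k : pred (seq L) :=
  if k is k'.+1 then allW (allW (fun v => t <= cntW n (goodW n t k') v)%N) else xpredT.

Lemma cnt_res n h (Q : pred (Conf L h)) v :
  cnt n Q (res W (n + h) v) = cntW n (fun v => Q (res W h v)) v.
Proof.
elim: n v => //= n IH v; apply: eq_bigr => i _.
by rewrite ffunE/=; case: ifP => // _; exact: IH.
Qed.

Lemma eq_cntW n Q Q' v : Q =1 Q' -> cntW n Q v = cntW n Q' v.
Proof.
move=> QQ; elim: n v => [|n IH] v /=; first by rewrite QQ.
by apply: eq_bigr => i _; rewrite IH.
Qed.

Lemma allk_res h (Q : pred (Conf L h)) v :
  allk Q (res W h.+1 v) = allW (fun v => Q (res W h v)) v.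
Proof. by apply: eq_forallb => i; rewrite ffunE. Qed.

Lemma eq_allW Q Q' v : Q =1 Q' -> allW Q v = allW Q' v.
Proof. by move=> QQ; apply: eq_forallb => i; rewrite QQ. Qed.

Lemma goodc_res n t k v : goodc L n t k (res W (good_height n k) v) = goodW n t k v.
Proof.
elim: k v => // k IH v.
rewrite [LHS]allk_res; apply: eq_allW => {}v.
rewrite [LHS]allk_res; apply: eq_allW => {}v.
rewrite cnt_res; congr (_ <= _)%N; exact: eq_cntW.
Qed.

Lemma cntW_mono n Q Q' v : (forall v, Q v -> Q' v) -> (cntW n Q v <= cntW n Q' v)%N.
Proof.
move=> QQ; elim: n v => [|n IH] v /=; first by case: (Q v) (QQ v) => // ->.
by apply: leq_sum => i _; case: ifP.
Qed.

Lemma allW_mono Q Q' v : (forall v, Q v -> Q' v) -> allW Q v -> allW Q' v.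
Proof.
move=> QQ /forallP H; apply/forallP => i.
by have /andP[-> /QQ] := H i.
Qed.

Lemma goodWS n t k v : goodW n t k.+1 v -> goodW n t k v.
Proof.
elim: k v => // k IH v; apply: allW_mono => {}v; apply: allW_mono => {}v.
by move=> h; apply: leq_trans h _; exact: cntW_mono.
Qed.

Lemma goodW_anti n t k k' v : (k <= k')%N -> goodW n t k' v -> goodW n t k v.
Proof.
move=> /subnK <-; elim: (k' - k)%N => // j IH /goodWS; exact: IH.
Qed.

End good_vertices.

(** * Vertices good to every depth *)

Section good_vertex.
Variables (R : realType) (dO : measure_display) (Omega : measurableType dO).
Variables (P : probability Omega R) (b d : nat) (p : R).
Local Notation L := (Alph b d).
Variable W : seq L -> Omega -> {set L}.
Hypotheses (p0 : 0 < p) (p1 : p < 1) (m1 : 1 < p * #|L|%:R).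
Hypothesis mW : forall a B, measurable [set w : Omega | W a w = B].
Hypothesis PW : forall (s : seq (seq L)) (B : seq L -> {set L}), uniq s ->
  P [set w : Omega | forall a, a \in s -> W a w = B a] =
  (\prod_(a <- s) (p ^+ #|B a| * (1 - p) ^+ #|~: B a|))%:E.

Lemma all_gen_res (V : seq L -> {set L}) n h (Q : pred (Conf L h)) v :
  all_gen n Q (res V (n + h) v) <->
  forall u, size u = n -> inT_from V v u -> Q (res V h (v ++ u)).
Proof.
elim: n v => [|n IH] v /=.
  by split=> [H u /size0nil -> _|/(_ [::] erefl I)]; rewrite cats0.
split=> [/forallP H [//|i u] /= [un] [iv uT]|H].
  rewrite -cat_rcons; apply: (IH (rcons v i)).1 un uT.
  by have := H i; rewrite ffunE/= iv.
apply/forallP => i; rewrite ffunE/=; apply/implyP => iv; apply/IH => u un uT.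
by rewrite cat_rcons; apply: H => /=; rewrite ?un.
Qed.

Variables n t : nat.
Let q := qstar L p.
Hypotheses (n_large : 1 <= (p * #|L|%:R) ^+ n * q) (t_small : t%:R <= (p * #|L|%:R) ^+ n * q / 2).

Let Wt w : seq L -> {set L} := fun a => W a w.

Let barren j k : pred (Conf L (j + good_height n k)) := fun x =>
  all_gen j (fun y => ~~ goodc L n t k y) x && ~~ all_gen j (fun _ => false) x.

Let Barren j k := [set w | @barren j k (res (Wt w) _ [::])].

(** Barrenness is the event that no vertex of generation [j] is good, minus extinction by generation
    [j]. The first has as probability an iterate of the generating function, started at the
    probability of not being good, which is at most [1 - q]. *)
Lemma prob_barren j k :
  (P (Barren j k) <= (iter j (genf L p) (1 - q) - iter j (genf L p) 0)%:E)%E.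
Proof.
have [_ h] := prob_res_pred mW PW [::] (@barren j k).
apply: le_trans h _; rewrite lee_fin /barren wprob_diff; last exact: all_gen_mono.
rewrite !wprob_all_gen// wprobC// -[wprob p _ in X in _ - X]/(wexp p (fun _ => 0)) wexp0 lerD2r.
have qp : q <= wprob p (goodc L n t k) by apply: wprob_goodc.
have pr1 : wprob p (goodc L n t k) <= 1.
  by rewrite -subr_ge0 -wprobC// wprob_ge0.
apply: iter_genf_mono => //; rewrite ?subr_ge0//; first by rewrite lerD2l lerN2.
by rewrite gerBl ltW// qstar_gt0.
Qed.

Lemma barrenP j k w : Barren j k w <->
  (forall u, size u = j -> inT (Wt w) u -> ~~ goodW (Wt w) n t k u) /\
  (exists2 u, size u = j & inT (Wt w) u).
Proof.
split=> [/andP[h1 h2]|[H [u uj uT]]].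
  split=> [u uj uT|].
    by have := (all_gen_res _ _ _ _).1 h1 u uj uT; rewrite goodc_res.
  apply: contrapT => H; move/negP: h2; apply; apply/all_gen_res => u uj uT.
  by exfalso; apply: H; exists u.
apply/andP; split.
  by apply/all_gen_res => v vj vT; rewrite goodc_res; exact: H.
by apply/negP => /all_gen_res /(_ u uj uT).
Qed.

Lemma ae_good_vertex : {ae P, forall w, nonextinct (fun a => W a w) ->
  exists v, inT (fun a => W a w) v /\ forall k, goodW (fun a => W a w) n t k v}.
Proof.
have mB j k : measurable (Barren j k).
  by have [] := prob_res_pred mW PW [::] (@barren j k).
have mU j : measurable (\bigcup_k Barren j k) by exact: bigcupT_measurable.
(* A nonextinct tree with no vertex good to every depth is barren in each generation [j] for some
   depth [k]. *)
exists (\bigcap_j \bigcup_k Barren j k); split.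
- exact: bigcapT_measurable.
- set A := \bigcap_j _; have mA : measurable A by exact: bigcapT_measurable.
  have PA j : (P A <= (iter j (genf L p) (1 - q) - iter j (genf L p) 0)%:E)%E.
    apply: (@le_trans _ _ (P (\bigcup_k Barren j k))).
      by rewrite le_measure ?inE// => w; apply.
    (* Barrenness increases with [k], so the bound uniform in [k] passes to the union. *)
    have c : (P \o Barren j) @ \oo --> P (\bigcup_k Barren j k).
      apply: nondecreasing_cvg_mu => // k k' kk'; apply/subsetPset => w.
      move=> /barrenP[H1 H2]; apply/barrenP; split => // u uj uT.
      by apply: contra (H1 u uj uT); exact: goodW_anti.
    rewrite -(cvg_lim _ c)//; apply: lime_le; first by apply/cvg_ex; exists (P (\bigcup_k Barren j k)).
    by apply: nearW => k; exact: prob_barren.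
  have fA : P A \is a fin_num by exact: fin_num_measure.
  apply/eqP; rewrite eq_le measure_ge0 andbT -(fineK fA) lee_fin.
  have q1 : 0 < q by exact: qstar_gt0.
  have q1' : q <= 1 by have := @wprob_goodc _ L p p0 p1 n t 0 m1 n_large t_small; rewrite [wprob _ _](_ : _ = 1)//; exact: wexp1.
  have c : (fun j => iter j (genf L p) (1 - q) - iter j (genf L p) 0) @ \oo --> (0 : R).
    by apply: iter_genf_gap => //; rewrite ?subr_ge0// gtrBl.
  rewrite -(cvg_lim _ c)//; apply: limr_ge; first by apply/cvg_ex; exists 0.
  by apply: nearW => j; rewrite -lee_fin fineK.
move=> w /= /not_implyP[nw H] j _.
have bad u : size u = j -> inT (Wt w) u -> exists k, ~~ goodW (Wt w) n t k u.
  move=> _ uT; apply: contrapT => Hk; apply: H; exists u; split => // k.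
  by apply: contrapT => /negP Hn; apply: Hk; exists k.
have /choice[f Hf] (u : j.-tuple L) :
    exists k, inT (Wt w) u -> ~~ goodW (Wt w) n t k u.
  have [uT|nuT] := pselect (inT (Wt w) u); last by exists 0.
  by have [k Hk] := bad u (size_tuple u) uT; exists k.
(* There are finitely many words of length [j], so the largest of their failing depths serves all of
   them. *)
exists (\max_u f u)%N => //; apply/barrenP; split; last first.
  by have [u [? ?]] := nw j; exists u.
move=> u uj uT; pose u' := tcast uj (in_tuple u).
have e : u = u' :> seq _ by rewrite val_tcast.
rewrite e; rewrite e in uT; apply: contra (Hf _ uT); apply: goodW_anti.
exact: leq_bigmax.
Qed.

End good_vertex.

(** * Regular subtrees below good vertices *)

Section tree_words.
Variables (b d : nat) (W : seq (Alph b d) -> {set Alph b d}).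
Local Notation L := (Alph b d).
Implicit Types (v u : seq L).

Lemma inT_from_cat v u u' :
  inT_from W v (u ++ u') <-> inT_from W v u /\ inT_from W (v ++ u) u'.
Proof.
elim: u v => [|i u IH] v /=; first by rewrite cats0; split=> [|[]].
by rewrite -cat_rcons; split=> [[? /IH[? ?]]|[[? ?] ?]]; do ?split=> //; apply/IH.
Qed.

Fixpoint desc n v : seq (seq L) :=
  if n is n'.+1 then [seq i :: u | i <- enum (W v), u <- desc n' (rcons v i)]
  else [:: [::]].

Lemma descP n v u : u \in desc n v -> size u = n /\ inT_from W v u.
Proof.
elim: n v u => [|n IH] v u /=; first by rewrite inE => /eqP->.
move=> /allpairsPdep[i [w [hi hw ->]]] /=; have [-> ?] := IH _ _ hw.
by rewrite mem_enum in hi.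
Qed.

Lemma desc_uniq n v : uniq (desc n v).
Proof.
elim: n v => //= n IH v; apply: allpairs_uniq_dep; [exact: enum_uniq|by move=> i _|].
by move=> [i u] [j w] _ _ /= [-> ->].
Qed.

Lemma cntW_desc n (Q : pred (seq L)) v :
  cntW W n Q v = count (fun u => Q (v ++ u)) (desc n v).
Proof.
elim: n v => [|n IH] v /=; first by rewrite cats0 addn0.
rewrite count_flatten sumnE !big_map big_enum/= [in RHS]big_mkcond/=.
apply: eq_bigr => i _; case: ifP => // _; rewrite IH count_map.
by apply: eq_count => u /=; rewrite cat_rcons.
Qed.
Definition very_good n t v := forall k, goodW W n t k v.

(** A vertex that is not good to every depth fails from some depth on; on a finite list the maximum
    of these depths serves. *)
Lemma goodW_stabilizes n t v (s : seq (seq L)) :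
  exists k, forall u, u \in s -> goodW W n t k (v ++ u) -> very_good n t (v ++ u).
Proof.
elim: s => [|u s [k Hk]]; first by exists 0.
have [ug|/existsNP[k' Hk']] := pselect (very_good n t (v ++ u)).
  by exists k => w; rewrite inE => /orP[/eqP-> //|]; exact: Hk.
exists (maxn k k') => w; rewrite inE => /orP[/eqP->|ws] h.
  by case: Hk'; apply: goodW_anti h; exact: leq_maxr.
by apply: Hk => //; apply: goodW_anti h; exact: leq_maxl.
Qed.

(** At a depth where goodness has stabilized on the finitely many descendants, those that are good
    are good to every depth. *)
Lemma very_good_desc n t v : (forall k, (t <= cntW W n (goodW W n t k) v)%N) ->
  exists s, [/\ uniq s, size s = t & forall u, u \in s ->
    [/\ size u = n, inT_from W v u & very_good n t (v ++ u)]].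
Proof.
have [k Hk] := @goodW_stabilizes n t v (desc n v); move=> /(_ k).
rewrite cntW_desc -size_filter => tk.
exists (take t [seq u <- desc n v | goodW W n t k (v ++ u)]); split.
- by rewrite take_uniq// filter_uniq// desc_uniq.
- by rewrite size_takel.
- move=> u /mem_take; rewrite mem_filter => /andP[gu ud].
  by have [? ?] := descP ud; split => //; exact: Hk.
Qed.

(** Goodness forces two full generations, and [t] very good descendants are selected below each
    grandchild. The clause on [c :: c :: u] provides children near every corner of the cube. *)
Lemma very_good_children n t v : (0 < t)%N -> very_good n t v ->
  exists s, [/\ uniq s, size s = (#|L| * #|L| * t)%N,
    forall u, u \in s -> [/\ size u = n.+2, inT_from W v u & very_good n t (v ++ u)] &
    forall c : L, exists u, c :: c :: u \in s].
Proof.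
move=> t0 vg.
have W1 i : i \in W v by have /forallP/(_ i)/andP[] := vg 1.
have W2 i j : j \in W (rcons v i).
  by have /forallP/(_ i)/andP[_ /forallP/(_ j)/andP[]] := vg 1.
have /choice[F HF] (ij : L * L) : exists s, [/\ uniq s, size s = t & forall u, u \in s ->
    [/\ size u = n, inT_from W (rcons (rcons v ij.1) ij.2) u &
      very_good n t (rcons (rcons v ij.1) ij.2 ++ u)]].
  apply: (@very_good_desc n t (rcons (rcons v ij.1) ij.2)) => k.
  by have /forallP/(_ ij.1)/andP[_ /forallP/(_ ij.2)/andP[]] := vg k.+1.
exists [seq ij.1 :: ij.2 :: u | ij <- enum {: L * L}, u <- F ij]; split.
- apply: allpairs_uniq_dep; [exact: enum_uniq|by move=> ij _; have [] := HF ij|].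
  by move=> [[i j] u] [[i' j'] u'] _ _ /= [-> -> ->].
- rewrite size_allpairs_dep sumnE big_map big_enum/=.
  rewrite (eq_bigr (fun=> t)) => [|ij _]; last by have [] := HF ij.
  by rewrite sum_nat_const card_prod.
- move=> u /allpairsPdep[[i j] [w [_ hw ->]]] /=.
  have [_ _ /(_ w hw)/=[-> wT wg]] := HF (i, j).
  by rewrite -!cat_rcons.
move=> c; have [_ st _] := HF (c, c).
have /hasP[u uF _] : has predT (F (c, c)) by rewrite has_predT st.
by exists u; apply/allpairsPdep; exists (c, c), u; rewrite mem_enum.
Qed.

End tree_words.

(** * Cubes *)

Local Notation edist := Defs.edist.

Section cubes.
Variables (R : realType) (b d : nat).
Hypothesis b2 : (2 <= b)%N.
Local Notation L := (Alph b d).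
Implicit Types (v u : seq L) (t : 'I_d) (x y : 'rV[R]_d).

Let b0 : 0 < b%:R :> R. Proof. by rewrite ltr0n (leq_trans _ b2). Qed.

Fixpoint corner v t : R :=
  if v is i :: v' then ((i t : nat)%:R + corner v' t) / b%:R else 0.

Definition side v : R := b%:R ^- size v.

Definition cube v : set 'rV[R]_d :=
  [set x | forall t, corner v t <= x ord0 t <= corner v t + side v].

Lemma side_gt0 v : 0 < side v.
Proof. by rewrite invr_gt0 exprn_gt0. Qed.

Lemma side_cat v u : side (v ++ u) = side v * side u.
Proof. by rewrite /side size_cat exprD invfM. Qed.

Lemma corner_cat v u t : corner (v ++ u) t = corner v t + side v * corner u t.
Proof.
elim: v => [|i v IH] /=; first by rewrite /side expr0 invr1 mul1r add0r.
rewrite IH /side /= exprS invfM; ring.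
Qed.

Lemma corner_bounds v t : 0 <= corner v t /\ corner v t + side v <= 1.
Proof.
elim: v => [|i v [IH0 IH1]] /=; first by rewrite /side expr0 invr1 add0r.
split; first by rewrite divr_ge0 ?addr_ge0// ltW.
rewrite /side /= exprS invfM mulrC -mulrDr ler_pdivrMl// mulr1.
have : (i t : nat)%:R + 1 <= b%:R :> R by rewrite natr1 ler_nat.
move: IH1; rewrite /side; lra.
Qed.

Lemma cube_cat v u : cube (v ++ u) `<=` cube v.
Proof.
move=> x xu t; have /andP[h1 h2] := xu t; have [c0 c1] := corner_bounds u t.
rewrite side_cat corner_cat in h1 h2; have s0 := side_gt0 v; apply/andP; split.
  by apply: le_trans h1; rewrite lerDl mulr_ge0// ltW.
by apply: le_trans h2 _; rewrite -addrA lerD2l -mulrDr ler_piMr// ltW.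
Qed.

Lemma edist_coord x y t : `|x ord0 t - y ord0 t| <= edist x y.
Proof.
rewrite -sqrtr_sqr /edist ler_wsqrtr// (bigD1 t)//= lerDl.
by apply: sumr_ge0 => i _; exact: sqr_ge0.
Qed.

Lemma edist_ge0 x y : 0 <= edist x y. Proof. exact: sqrtr_ge0. Qed.

Lemma sqr_sum_le (I : Type) (r : seq I) (F : I -> R) :
  (forall i, 0 <= F i) -> \sum_(i <- r) F i ^+ 2 <= (\sum_(i <- r) F i) ^+ 2.
Proof.
move=> F0; elim: r => [|i r IH]; first by rewrite !big_nil expr0n.
rewrite !big_cons sqrrD -addrA lerD2l (le_trans IH)// lerDr mulrn_wge0// mulr_ge0//.
exact: sumr_ge0.
Qed.

Lemma edist_le x y (e : R) : 0 <= e -> (forall t, `|x ord0 t - y ord0 t| <= e) ->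
  edist x y <= d%:R * e.
Proof.
move=> e0 H; have s0 : 0 <= \sum_t `|x ord0 t - y ord0 t| by apply: sumr_ge0.
apply: (@le_trans _ _ (\sum_t `|x ord0 t - y ord0 t|)).
  rewrite -(ger0_norm s0) -sqrtr_sqr /edist ler_wsqrtr//.
  apply: le_trans (sqr_sum_le _ _) => //.
  by apply: ler_sum => t _; rewrite real_normK// num_real.
apply: le_trans (ler_sum _ (fun t _ => H t)) _.
by rewrite sumr_const card_ord mulr_natl.
Qed.

Lemma cube_dist v x y : cube v x -> cube v y ->
  forall t, `|x ord0 t - y ord0 t| <= side v.
Proof.
move=> xv yv t; have /andP[? ?] := xv t; have /andP[? ?] := yv t.
by rewrite ler_norml; apply/andP; split; lra.
Qed.

Lemma cube_edist v x y : cube v x -> cube v y -> edist x y <= d%:R * side v.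
Proof. by move=> xv yv; apply: edist_le (cube_dist xv yv); rewrite ltW// side_gt0. Qed.

Lemma cube_closed v : closed (cube v).
Proof.
rewrite (_ : cube v = \bigcap_(t : 'I_d)
  ((fun x : 'rV[R]_d => x ord0 t) @^-1` `[corner v t, corner v t + side v]%classic)).
  apply: closed_bigI => t _; apply: closed_comp; last exact: itv_closed.
  by move=> x _; exact: coord_continuous.
apply/seteqP; split => x /= H t; first by move=> _; rewrite /= in_itv/=; exact: H.
by have := H t I; rewrite /= in_itv.
Qed.

Lemma corner_mkseq (i : nat -> L) n t :
  corner (mkseq i n) t = \sum_(0 <= k < n) ((i k t : nat)%:R / (b%:R ^+ k.+1)).
Proof.
elim: n => [|n IH]; first by rewrite big_nil.
rewrite mkseqS -cats1 corner_cat IH big_nat_recr//= addr0; congr (_ + _).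
by rewrite /side size_mkseq exprSr invfM mulrCA.
Qed.

Lemma side_mkseq (i : nat -> L) n : side (mkseq i n) = b%:R ^- n.
Proof. by rewrite /side size_mkseq. Qed.

Lemma mkseq_add (i : nat -> L) n k :
  mkseq i (n + k) = mkseq i n ++ mkseq (fun j => i (n + j)%N) k.
Proof.
rewrite /mkseq iotaD map_cat add0n; congr (_ ++ _).
by rewrite -{1}(addn0 n) iotaDl -map_comp.
Qed.

Lemma gammab_cube (i : nat -> L) n : cube (mkseq i n) (gammab i).
Proof.
move=> t; rewrite /gammab mxE.
set u := (fun n => _).
have uE k : u k = corner (mkseq i k) t by rewrite corner_mkseq.
have nd : {homo u : j k / (j <= k)%N >-> j <= k}.
  apply/nondecreasing_seqP => k; rewrite !uE -addn1 mkseq_add corner_cat lerDl.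
  rewrite mulr_ge0 ?(ltW (side_gt0 _))//.
  by have [] := corner_bounds (mkseq (fun j => i (k + j)%N) 1) t.
have ub k : u k <= u n + side (mkseq i n).
  have h m : u (n + m)%N <= u n + side (mkseq i n).
    rewrite !uE mkseq_add corner_cat lerD2l ler_piMr// ?(ltW (side_gt0 _))//.
    have [_ h] := corner_bounds (mkseq (fun j => i (n + j)%N) m) t.
    by apply: le_trans h; rewrite lerDl ltW// side_gt0.
  by apply: le_trans (h k); apply: nd; exact: leq_addl.
have cu : cvgn u.
  apply: nondecreasing_is_cvgn => //; exists (u n + side (mkseq i n)) => _ [k _ <-].
  exact: ub.
rewrite -uE; apply/andP; split; first exact: nondecreasing_cvgn_le.
by apply: limr_le => //; apply: nearW => k; exact: ub.
Qed.

Lemma exists_exp_lt (c e : R) : 0 < e -> exists n, c * b%:R ^- n < e.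
Proof.
move=> e0; pose n := Num.truncn (c / e); exists n.+1.
rewrite -/(_ / _) ltr_pdivrMr ?exprn_gt0// mulrC -ltr_pdivrMr//.
apply: (@lt_le_trans _ _ n.+1%:R); first exact: truncnS_gt.
by rewrite -natrX ler_nat ltnW// ltn_expl.
Qed.

Lemma eq_of_exp_bound (x y : R) : (forall n, `|x - y| <= b%:R ^- n) -> x = y.
Proof.
move=> H; apply/eqP; rewrite -subr_eq0 -normr_le0 leNgt; apply/negP => xy.
by have [n] := exists_exp_lt 1 xy; rewrite mul1r ltNge H.
Qed.

Lemma cube_gammab (i : nat -> L) x : (forall n, cube (mkseq i n) x) -> x = gammab i.
Proof.
move=> H; apply/rowP => t; apply: eq_of_exp_bound => n.
rewrite -(side_mkseq i); exact: (cube_dist (H n) (gammab_cube i n)).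
Qed.

(** The integer whose base-[b] digits are the coordinates of the letters in direction [t]; it
    locates the cube on the grid of mesh [side v]. *)
Definition idx v t : nat := foldl (fun a (i : L) => a * b + i t)%N 0%N v.

Lemma idx_rcons v i t : idx (rcons v i) t = (idx v t * b + i t)%N.
Proof. by rewrite /idx -cats1 foldl_cat. Qed.

Lemma cornerE v t : corner v t = (idx v t)%:R * side v.
Proof.
elim/last_ind: v => [|v i IH]; first by rewrite mul0r.
rewrite idx_rcons -cats1 corner_cat side_cat IH/= addr0 natrD natrM.
have -> : side [:: i] = b%:R^-1 by rewrite /side expr1.
by move: (side v) => s; field; rewrite lt0r_neq0.
Qed.

Lemma idx_inj v u : size v = size u -> (forall t, idx v t = idx u t) -> v = u.
Proof.
elim/last_ind: v u => [|v i IH] u; first by move=> /esym/size0nil ->.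
case/lastP: u => [|u j]; first by rewrite size_rcons.
rewrite !size_rcons => -[suv] H.
have bpos : (0 < b)%N by rewrite (leq_trans _ b2).
have e t : idx v t = idx u t /\ i t = j t.
  have := H t; rewrite !idx_rcons => h; split.
    have /(congr1 (fun a => a %/ b)%N) := h.
    by rewrite !divnMDl// !divn_small// !addn0.
  apply: val_inj; have /(congr1 (fun a => a %% b)%N) := h.
  by rewrite !modnMDl !modn_small.
by rewrite (IH u suv (fun t => (e t).1)); congr rcons; apply/ffunP => t; exact: (e t).2.
Qed.

End cubes.

(** * The limit set of a regular subtree *)

Section regular_subtree.
Variables (R : realType) (b d : nat).
Hypothesis b2 : (2 <= b)%N.
Local Notation L := (Alph b d).
Variables (W : seq L -> {set L}) (N M : nat) (good : seq L -> Prop).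
Variables (ch : seq L -> seq (seq L)) (v0 : seq L) (c0 : L).
Hypotheses (N0 : (0 < N)%N) (M0 : (0 < M)%N).
Hypotheses (good_v0 : good v0) (good_inT : forall v, good v -> inT W v).
Hypothesis chP : forall v, good v -> [/\ uniq (ch v), size (ch v) = M,
  forall u, u \in ch v -> size u = N /\ good (v ++ u) &
  forall c : L, exists u, c :: c :: u \in ch v].

(** The base-[M] digits of [J] are the choices of child along a path: [J %% M] is the last one and
    [J %/ M] encodes the parent. Generation [k] is numbered by [J < M ^ k]. *)
Fixpoint node k (J : nat) : seq L :=
  if k is k'.+1 then node k' (J %/ M)%N ++ nth [::] (ch (node k' (J %/ M)%N)) (J %% M)%N else v0.

Definition lev k := (size v0 + k * N)%N.

Lemma good_node k J : good (node k J).
Proof.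
elim: k J => //= k IH J; have [_ sM + _] := chP (IH (J %/ M)%N).
by move=> /(_ (nth [::] (ch (node k (J %/ M)%N)) (J %% M)%N))[]//; rewrite mem_nth// sM ltn_mod.
Qed.

Lemma size_node k J : size (node k J) = lev k.
Proof.
elim: k J => [|k IH] J /=; first by rewrite /lev mul0n addn0.
rewrite size_cat IH /lev mulSn (addnC N) addnA; congr (_ + _)%N.
have [_ sM + _] := chP (good_node k (J %/ M)%N).
by move=> /(_ (nth [::] (ch (node k (J %/ M)%N)) (J %% M)%N))[]//; rewrite mem_nth// sM ltn_mod.
Qed.

Lemma node_inj k J J' : (J < M ^ k)%N -> (J' < M ^ k)%N -> node k J = node k J' -> J = J'.
Proof.
elim: k J J' => [|k IH] J J' /=; first by rewrite !ltnS !leqn0 => /eqP-> /eqP->.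
rewrite expnSr => JM JM' /eqP; rewrite eqseq_cat ?size_node// => /andP[/eqP e1 /eqP e2].
have q : (J %/ M)%N = (J' %/ M)%N by apply: IH => //; rewrite ltn_divLR.
rewrite (divn_eq J M) (divn_eq J' M) q; congr (_ + _)%N.
have [uc sM _ _] := chP (good_node k (J' %/ M)%N).
by rewrite q in e2; apply/eqP; rewrite -(nth_uniq [::] _ _ uc) ?sM ?ltn_mod// e2.
Qed.

Lemma node_ancestor k j J : exists u, node (k + j) J = node k (J %/ M ^ j)%N ++ u.
Proof.
elim: j J => [|j IH] J; first by exists [::]; rewrite addn0 expn0 divn1 cats0.
have [u e] := IH (J %/ M)%N; rewrite addnS /= e -divnMA -expnS -catA.
by eexists.
Qed.

Lemma cube_node_ancestor k j J :
  cube (node (k + j) J) `<=` cube (R := R) (node k (J %/ M ^ j)%N).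
Proof. by have [u ->] := node_ancestor k j J; exact: cube_cat. Qed.

Definition coherent (J : nat -> nat) := forall k, (J k.+1 %/ M)%N = J k.

Lemma coherent_add J k j : coherent J -> (J (k + j) %/ M ^ j)%N = J k.
Proof.
move=> cJ; elim: j => [|j IH]; first by rewrite addn0 expn0 divn1.
by rewrite addnS expnS divnMA cJ.
Qed.

(** Nodes of level [i.+1] are longer than [i] since [N] is positive, so the default letter is never
    returned. *)
Definition word (J : nat -> nat) (i : nat) : L := nth c0 (node i.+1 (J i.+1)) i.

Lemma lev_ge k : (k <= lev k)%N.
Proof. by rewrite /lev (leq_trans (leq_pmulr k N0))// leq_addl. Qed.

Lemma mkseq_word J k n : coherent J -> (n <= lev k)%N ->
  mkseq (word J) n = take n (node k (J k)).
Proof.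
move=> cJ nk; have sz : size (take n (node k (J k))) = n by rewrite size_takel ?size_node.
apply: (@eq_from_nth _ c0); rewrite ?size_mkseq ?sz// => i iN.
rewrite nth_mkseq// nth_take// /word.
(* Along a coherent path both nodes are prefixes of the node on level [maxn i.+1 k], so they agree
   at position [i]. *)
have [[u e1] [w e2]] :
    (exists u, node (maxn i.+1 k) (J (maxn i.+1 k)) = node i.+1 (J i.+1) ++ u) /\
    (exists u, node (maxn i.+1 k) (J (maxn i.+1 k)) = node k (J k) ++ u).
  split.
    have [u] := node_ancestor i.+1 (maxn i.+1 k - i.+1) (J (maxn i.+1 k)).
    rewrite -{3}(subnKC (leq_maxl i.+1 k)) coherent_add// subnKC ?leq_maxl// => ->.
    by exists u.
  have [u] := node_ancestor k (maxn i.+1 k - k) (J (maxn i.+1 k)).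
  rewrite -{3}(subnKC (leq_maxr i.+1 k)) coherent_add// subnKC ?leq_maxr// => ->.
  by exists u.
transitivity (nth c0 (node (maxn i.+1 k) (J (maxn i.+1 k))) i).
  by rewrite e1 nth_cat size_node (leq_trans _ (lev_ge _)).
by rewrite e2 nth_cat size_node (leq_trans iN nk).
Qed.

(** * The limit set and its description by paths *)

Definition point J : 'rV[R]_d := gammab (word J).

Lemma point_cube J k : coherent J -> cube (node k (J k)) (point J).
Proof.
move=> cJ; have := @gammab_cube R b d b2 (word J) (lev k).
by rewrite (mkseq_word cJ (leqnn _)) take_oversize ?size_node.
Qed.

Definition moran : set 'rV[R]_d :=
  \bigcap_k \bigcup_(J in `I_((M ^ k)%N)) cube (node k J).

Lemma moran_closed : closed moran.
Proof.
apply: closed_bigI => k _; apply: closed_bigcup => [|J _]; first exact: finite_II.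
exact: cube_closed.
Qed.

Lemma coherent_bound J k : coherent J -> J 0%N = 0%N -> (J k < M ^ k)%N.
Proof.
move=> cJ J0; elim: k => [|k IH]; first by rewrite J0.
by rewrite expnSr -ltn_divLR// cJ.
Qed.

Lemma point_moran J : coherent J -> J 0%N = 0%N -> moran (point J).
Proof.
by move=> cJ J0 k _; exists (J k); [exact: coherent_bound|exact: point_cube].
Qed.

(* Koenig's lemma. *)
Lemma moran_point x : moran x -> exists J, [/\ coherent J, J 0%N = 0%N & x = point J].
Proof.
move=> xD.
(* Neighbouring closed cubes share faces, so the cubes around [x] on successive levels need not be
   nested; hereditary nodes are those through which the path can be continued. *)
pose hereditary k J := forall j, exists J', (J' %/ M ^ j)%N = J /\ cube (node (k + j) J') x.
have h0 : hereditary 0%N 0%N.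
  move=> j; have [J' /= J'M xJ'] := xD j I.
  by exists J'; rewrite add0n divn_small.
have step k J : hereditary k J -> exists J1, (J1 %/ M)%N = J /\ hereditary k.+1 J1.
  move=> hJ; apply: contrapT => Hn.
  (* If no child were hereditary, each child [r] would fail at some depth [f r]; a descendant of [J]
     one level beyond the maximum passes through a child and contradicts this. *)
  have /choice[f Hf] (r : 'I_M) : exists j, forall J',
      (J' %/ M ^ j)%N = (J * M + r)%N -> ~ cube (node (k.+1 + j) J') x.
    apply: contrapT => Hr; apply: Hn; exists (J * M + r)%N; split.
      by rewrite divnMDl// divn_small ?addn0.
    move=> j; apply: contrapT => Hj; apply: Hr; exists j => J' e xJ'; apply: Hj.
    by exists J'.
  pose j := (\max_r f r)%N; have [J' [e xJ']] := hJ j.+1.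
  pose J1 := (J' %/ M ^ j)%N.
  have eJ1 : (J1 %/ M)%N = J by rewrite /J1 -divnMA -expnSr.
  pose r := Ordinal (ltn_pmod J1 M0).
  have fj : (f r <= j)%N by exact: leq_bigmax.
  apply: (Hf r (J' %/ M ^ (j - f r))%N).
    by rewrite -divnMA -expnD subnK// -/J1 -eJ1 -divn_eq.
  apply: cube_node_ancestor.
  by rewrite -addnA subnKC// addSnnS.
have /choice[g Hg] (kJ : nat * nat) : exists J1,
    hereditary kJ.1 kJ.2 -> (J1 %/ M)%N = kJ.2 /\ hereditary kJ.1.+1 J1.
  have [h|nh] := pselect (hereditary kJ.1 kJ.2); last by exists 0%N.
  by have [J1 HJ1] := step _ _ h; exists J1.
pose J := fix J k := if k is k'.+1 then g (k', J k') else 0%N.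
have hJ k : hereditary k (J k) by elim: k => //= k IH; have [] := Hg (k, J k) IH.
have cJ : coherent J by move=> k; have [] := Hg (k, J k) (hJ k).
exists J; split => //; apply: cube_gammab => // n.
rewrite (mkseq_word cJ (lev_ge n)).
have [J' [+ +]] := hJ n 0%N; rewrite expn0 divn1 addn0 => -> xn.
by rewrite -(cat_take_drop n (node n (J n))) in xn; exact: cube_cat xn.
Qed.

Lemma moran_limit_set : moran `<=` limit_set W.
Proof.
move=> x /moran_point[J [cJ J0 ->]]; exists (word J) => //= n.
rewrite (mkseq_word cJ (lev_ge n)).
have := good_inT (good_node n (J n)).
by rewrite -{1}(cat_take_drop n (node n (J n))) /inT => /inT_from_cat[].
Qed.

(* The base-M expansion of x selects a path in the subtree; in this way Lebesgue measure on
   [0, 1) is transported to the uniform measure on the limit set. *)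
Definition digits (x : R) k : nat := Num.truncn (M%:R ^+ k * x).

(** The integer part of [y] is the quotient by [M] of the integer part of [M y]. Truncation sends
    negative numbers to 0, so coherence holds on the whole line and every [param x] is the point of
    a path. *)
Lemma digits_coherent x : coherent (digits x).
Proof.
move=> k; rewrite /digits exprSr mulrAC.
set y := _ * x; have M0R : 0 < M%:R :> R by rewrite ltr0n.
have [y0|y0] := leP 0 y; last first.
  have t0 (z : R) : z < 0 -> Num.truncn z = 0%N.
    by move=> z0; apply/truncn0Pn; rewrite -ltNge (lt_trans z0).
  by rewrite !t0 ?div0n// nmulr_rlt0.
apply/esym/truncn_def.
have /andP[h1 h2] := truncn_itv (mulr_ge0 y0 (ltW M0R)).
apply/andP; split.
  rewrite -(ler_pM2r M0R); apply: le_trans h1.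
  by rewrite -natrM ler_nat leq_trunc_div.
rewrite -(ltr_pM2r M0R); apply: lt_le_trans h2 _.
by rewrite -natrM ler_nat ltn_ceil.
Qed.

Lemma digits0 x : 0 <= x < 1 -> digits x 0%N = 0%N.
Proof.
by move=> /andP[x0 x1]; rewrite /digits expr0 mul1r; apply: truncn_def; rewrite x0.
Qed.

Definition param x := point (digits x).

Lemma param_cube x k : cube (node k (digits x k)) (param x).
Proof. exact: point_cube (digits_coherent x). Qed.

Lemma param_moran x : 0 <= x < 1 -> moran (param x).
Proof. by move=> x01; apply: point_moran; [exact: digits_coherent|exact: digits0]. Qed.

Lemma digits_bin k J : (J < M ^ k)%N ->
  exists2 x, 0 <= x < 1 & digits x k = J.
Proof.
move=> JM; have Mk0 : 0 < M%:R ^+ k :> R by rewrite exprn_gt0// ltr0n.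
exists (J%:R / M%:R ^+ k).
  apply/andP; split; first by rewrite divr_ge0// ltW.
  by rewrite ltr_pdivrMr// mul1r -natrX ltr_nat.
by rewrite /digits mulrC divfK ?natrK// lt0r_neq0.
Qed.

Lemma moran_meets_cube k J : (J < M ^ k)%N -> exists2 y, moran y & cube (node k J) y.
Proof.
move=> /digits_bin[x x01 <-]; exists (param x); [exact: param_moran|exact: param_cube].
Qed.

(** * Scales and hyperplane diffuseness *)

Let b0 : 0 < b%:R :> R. Proof. by rewrite ltr0n (leq_trans _ b2). Qed.

Definition sd k : R := b%:R ^- lev k.

Lemma sd_gt0 k : 0 < sd k.
Proof. by rewrite invr_gt0 exprn_gt0. Qed.

Lemma side_node k J : side R (node k J) = sd k.
Proof. by rewrite /side size_node. Qed.

Lemma sdS k : sd k = b%:R ^+ N * sd k.+1.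
Proof.
rewrite /sd /lev mulSn (addnC N) addnA [in RHS]exprD invfM mulrCA divff ?mulr1//.
by rewrite expf_neq0// lt0r_neq0.
Qed.

Lemma sd_lt (e : R) : 0 < e -> exists k, sd k < e.
Proof.
move=> e0; have [k kE] := @exists_exp_lt R b b2 1 e e0; exists k.
apply: le_lt_trans kE; rewrite mul1r /sd lef_pV2 ?posrE ?exprn_gt0//.
by rewrite ler_weXn2l ?lev_ge// ler1n (leq_trans _ b2).
Qed.

Lemma sd_le1 k : sd k <= 1.
Proof. by rewrite invf_le1 ?exprn_gt0// exprn_ege1// ler1n (leq_trans _ b2). Qed.

Lemma moran_meets_corner k J (c : L) : (J < M ^ k)%N ->
  exists2 y, moran y & cube (node k J ++ [:: c; c]) y.
Proof.
move=> JM; have [uc sM _ /(_ c)[u uch]] := chP (good_node k J).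
pose j := index [:: c, c & u] (ch (node k J)).
have jM : (j < M)%N by rewrite -sM index_mem.
have [|y yD yc] := @moran_meets_cube k.+1 (J * M + j).
  by rewrite expnSr -ltn_divLR// divnMDl// divn_small ?addn0.
exists y => //; move: yc; rewrite /= divnMDl// divn_small// addn0 modnMDl modn_small//.
rewrite nth_index// -[c :: c :: u]/([:: c; c] ++ u) catA; exact: cube_cat.
Qed.

Lemma near_hyperplane (a : 'rV[R]_d) (c e : R) (y : 'rV[R]_d) :
  0 < \sum_t `|a ord0 t| ->
  nbhd_of [set x : 'rV[R]_d | \sum_(t < d) a ord0 t * x ord0 t = c] e y ->
  `|\sum_(t < d) a ord0 t * y ord0 t - c| < (\sum_t `|a ord0 t|) * e.
Proof.
move=> a0 [z /= <- yz]; rewrite -sumrB.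
apply: (@le_lt_trans _ _ ((\sum_t `|a ord0 t|) * edist y z)); last by rewrite ltr_pM2l.
rewrite mulr_suml; apply: le_trans (ler_norm_sum _ _ _) _.
apply: ler_sum => t _; rewrite -mulrBr normrM ler_wpM2l//.
exact: edist_coord.
Qed.

(* The witnesses lie near the two opposite corners of the cube at which the linear form is
   extremal. *)
Lemma corner_gap k J (a : 'rV[R]_d) : (J < M ^ k)%N -> exists y z,
  [/\ moran y, moran z, cube (node k J) y, cube (node k J) z &
    (\sum_t `|a ord0 t|) * (sd k / 2) <=
      \sum_(t < d) a ord0 t * y ord0 t - \sum_(t < d) a ord0 t * z ord0 t].
Proof.
move=> JM; have bp : (0 < b)%N by rewrite (leq_trans _ b2).
have bm : (b.-1 < b)%N by rewrite prednK.
pose hi := Ordinal bm; pose lo := Ordinal bp.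
(* Two equal letters fix each coordinate up to [sd k / b ^ 2], so the coordinate gaps are at least
   [sd k * (1 - 2 / b ^ 2) >= sd k / 2]. A single letter would only give [sd k * (1 - 2 / b)], which
   vanishes for [b = 2]. *)
pose cp : L := [ffun t => if 0 <= a ord0 t then hi else lo].
pose cm : L := [ffun t => if 0 <= a ord0 t then lo else hi].
have [y yD yc] := moran_meets_corner cp JM.
have [z zD zc] := moran_meets_corner cm JM.
exists y, z; split => //; [exact: cube_cat yc|exact: cube_cat zc|].
rewrite -sumrB mulr_suml; apply: ler_sum => t _; rewrite -mulrBr.
have [/andP[y1 y2] /andP[z1 z2]] := (yc t, zc t).
move: y1 y2 z1 z2; rewrite !corner_cat !side_cat side_node /= !ffunE.
rewrite /side /= -/(b%:R ^- 2).
have s0 := sd_gt0 k; set s := sd k in s0 *; set cr := corner _ _.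
have b4 : b%:R ^- 2 <= 4^-1 :> R.
  rewrite lef_pV2 ?posrE ?exprn_gt0// -natrX ler_nat.
  by rewrite (leq_sqr 2 b).
have e1 : (b.-1%:R + (b.-1%:R + 0) / b%:R) / b%:R = 1 - b%:R ^- 2 :> R.
  have -> : b.-1%:R = b%:R - 1 :> R by rewrite -{2}(prednK bp) -natr1 addrK.
  by field; rewrite lt0r_neq0.
have e2 : (0%:R + (0%:R + 0) / b%:R) / b%:R = 0 :> R by rewrite !(add0r, mul0r).
have sb : s * b%:R ^- 2 <= s / 4 by rewrite ler_wpM2l// ltW.
have sb0 : 0 < s * b%:R ^- 2 by rewrite mulr_gt0// invr_gt0 exprn_gt0.
move: (y ord0 t) (z ord0 t) => yt zt.
case: (leP 0 (a ord0 t)) => at0 /=; rewrite e1 e2 => y1 y2 z1 z2.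
  rewrite ger0_norm// ler_wpM2l//; lra.
rewrite ltr0_norm// mulNr -mulrN ler_wnM2l ?(ltW at0)//; lra.
Qed.

Lemma moran_diffuse : (0 < d)%N -> hyperplane_diffuse moran.
Proof.
move=> d0; split; first exact: moran_closed.
have dR : 0 < d%:R :> R by rewrite ltr0n.
have bN : 0 < b%:R ^+ N :> R by rewrite exprn_gt0.
(* For [d sd k.+1 < xi <= d sd k] the ball contains a cube of generation [k.+1], and as
   [sd k = b ^ N sd k.+1], this [beta] makes [beta xi] at most a quarter of its side. The bound
   [d sd 0] on [xi] ensures that such a [k] exists. *)
exists (4 * (d%:R * b%:R ^+ N))^-1, (d%:R * sd 0); split.
  by rewrite invr_gt0 !mulr_gt0.
split; first by rewrite mulr_gt0// sd_gt0.
move=> xi xi0 xi1 x xD hL [a [c [a0 ->]]].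
have [k kxi kmin] : exists2 k, d%:R * sd k.+1 < xi & xi <= d%:R * sd k.
  have ex_k : exists k, d%:R * sd k < xi.
    have [k kE] := sd_lt (divr_gt0 xi0 dR); exists k.
    by rewrite mulrC -ltr_pdivlMr.
  case: (ex_minnP ex_k) => -[|k] h1 h2; first by rewrite ltNge (ltW xi1) in h1.
  by exists k => //; rewrite leNgt; apply/negP => /h2; rewrite ltnn.
have A0 : 0 < \sum_t `|a ord0 t|.
  rewrite lt_neqAle sumr_ge0 ?andbT//.
  apply: contra a0; rewrite eq_sym psumr_eq0// => /allP H.
  apply/eqP/rowP => t; rewrite mxE.
  by have := H t (mem_index_enum t); rewrite /= normr_eq0 => /eqP.
have [J JM xJ] := xD k.+1 I.
have [y [z [yD zD yJ zJ gap]]] := corner_gap a JM.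
have inball w : cube (node k.+1 J) w -> eball x xi w.
  move=> wJ; apply: le_lt_trans kxi; rewrite -(side_node k.+1 J).
  exact: cube_edist.
have small : (4 * (d%:R * b%:R ^+ N))^-1 * xi <= sd k.+1 / 4.
  rewrite mulrC ler_pdivrMr ?mulr_gt0//.
  have -> : sd k.+1 / 4 * (4 * (d%:R * b%:R ^+ N)) = d%:R * (b%:R ^+ N * sd k.+1) by field.
  by rewrite -sdS.
apply: contrapT => H.
have near w : moran w -> cube (node k.+1 J) w ->
    `|\sum_(t < d) a ord0 t * w ord0 t - c| < (\sum_t `|a ord0 t|) * (sd k.+1 / 4).
  move=> wD wJ; have wL : nbhd_of [set x : 'rV[R]_d | \sum_(t < d) a ord0 t * x ord0 t = c]
      ((4 * (d%:R * b%:R ^+ N))^-1 * xi) w.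
    by apply: contrapT => nw; apply: H; exists w; split => //; split => //; exact: inball.
  by apply: lt_le_trans (near_hyperplane A0 wL) _; rewrite ler_wpM2l// ltW.
(* If both points were near the hyperplane, their values would differ by less than half a side times
   the sum norm of [a], against [gap]. *)
move: (near y yD yJ) (near z zD zJ) gap.
rewrite !ltr_norml => /andP[_ h1] /andP[h2 _].
set A := \sum_t _ in h1 h2 *; set s := sd _ in h1 h2 *.
rewrite !mulrA in h1 h2 *; lra.
Qed.

Lemma eball_open (x : 'rV[R]_d) r : open (eball x r).
Proof.
rewrite (_ : eball x r = (fun y => edist x y) @^-1` `]-oo, r[%classic); last first.
  by apply/seteqP; split => y; rewrite /= in_itv.
apply: open_comp; last exact: interval_open.
have cont : continuous (fun y : 'rV[R]_d => \sum_(t < d) (x ord0 t - y ord0 t) ^+ 2).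
  apply: continuous_big => [|t _ z]; first exact: add_continuous.
  apply: (@continuous_comp _ _ _ (fun y : 'rV[R]_d => x ord0 t - y ord0 t) (fun z => z ^+ 2)).
    by apply: continuousB; [exact: cst_continuous|exact: coord_continuous].
  exact: exprn_continuous.
move=> y _; apply: (@continuous_comp _ _ _ (fun y : 'rV[R]_d => \sum_(t < d) (x ord0 t - y ord0 t) ^+ 2) Num.sqrt); first exact: cont.
exact: sqrt_continuous.
Qed.

Lemma nbhs_node (U : set 'rV[R]_d) x : open U -> U x ->
  exists k, forall J, cube (node k J) x -> cube (node k J) `<=` U.
Proof.
move=> oU Ux; have /nbhs_ballP[e /= e0 eU] : nbhs x U by exact: open_nbhs_nbhs.
have [k ke] := sd_lt e0; exists k => J xJ y yJ; apply: eU.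
split => // i t; rewrite (ord1 i); apply: le_lt_trans ke.
by rewrite -(side_node k J); exact: cube_dist.
Qed.

(** * The natural measure *)

Definition bin k J : set R := `[J%:R / M%:R ^+ k, J.+1%:R / M%:R ^+ k[%classic.

Let Mk0 k : 0 < M%:R ^+ k :> R. Proof. by rewrite exprn_gt0// ltr0n. Qed.

Lemma bin_digits k x : 0 <= x -> bin k (digits x k) x.
Proof.
move=> x0; rewrite /bin /= in_itv/= ler_pdivrMr// ltr_pdivlMr// (mulrC x).
exact: truncn_itv (mulr_ge0 (ltW (Mk0 k)) x0).
Qed.

Lemma digits_of_bin k J x : bin k J x -> digits x k = J.
Proof.
rewrite /bin /= in_itv/= ler_pdivrMr// ltr_pdivlMr// (mulrC x) => h.
exact: truncn_def.
Qed.

Lemma bin_sub k J : (J < M ^ k)%N -> bin k J `<=` `[0, 1[%classic.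
Proof.
move=> JM x; rewrite /bin /= !in_itv/= => /andP[x1 x2]; apply/andP; split.
  by apply: le_trans x1; rewrite divr_ge0// ltW.
apply: lt_le_trans x2 _; rewrite ler_pdivrMr// mul1r -natrX ler_nat//.
Qed.

Lemma lebesgue_bin k J : lebesgue_measure (bin k J) = (M%:R ^- k)%:E.
Proof.
rewrite lebesgue_measure_itv/= lte_fin ltr_pM2r ?invr_gt0// ltr_nat ltnSn.
by rewrite -EFinB -mulrBl -natr1 addrAC subrr add0r mul1r.
Qed.

Lemma measurable_digits k (P : set nat) :
  measurable ([set x | P (digits x k)] : set (measurableTypeR R)).
Proof.
rewrite (_ : [set x | _] = \bigcup_(j in P) [set x : R | digits x k = j]); last first.
  by apply/seteqP; split => [x Px|x [j Pj /= ->]//]; exists (digits x k).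
apply: bigcup_measurable => j _.
pose F i := `]-oo, i%:R / M%:R ^+ k[%classic : set R.
have mF i : measurable (F i : set (measurableTypeR R)) by exact: measurable_itv.
have FE i x : F i.+1 x = (digits x k <= i)%N :> Prop.
  by rewrite /F /= in_itv/= ltr_pdivlMr// /digits truncn_le_nat mulrC.
case: j => [|j].
  rewrite (_ : [set x | _] = F 1%N)//; apply/seteqP; split => x /=.
    by rewrite -/(F 1%N x) FE => ->.
  by rewrite -/(F 1%N x) FE leqn0 => /eqP.
rewrite (_ : [set x | _] = F j.+2 `\` F j.+1); first exact: measurableD.
apply/seteqP; split => x.
  by move=> /= e; split; rewrite FE e//; apply/negP; rewrite -ltnNge.
by move=> []; rewrite !FE => h1 /negP; rewrite -ltnNge => h2; apply/eqP; rewrite eqn_leq h1.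
Qed.

(** Open sets suffice. [param x] lies in an open [U] exactly when the cube of [x] in some generation
    [k] lies in [U], a condition on [digits x k] alone. *)
Lemma measurable_param :
  measurable_fun setT (param : measurableTypeR R -> Borel_Rd R d).
Proof.
apply: (@measurability _ _ _ (Borel_Rd R d) _ _ (@open 'rV[R]_d)) => //.
move=> _ [U oU <-]; rewrite setTI.
rewrite (_ : _ @^-1` U = \bigcup_k [set x | cube (node k (digits x k)) `<=` U]).
  apply: bigcupT_measurable => k.
  exact: (@measurable_digits k [set j | cube (node k j) `<=` U]).
apply/seteqP; split => x.
  move=> Ux; have [k kU] := nbhs_node oU Ux; exists k => //=.
  by apply: kU; exact: param_cube.
by move=> [k _ /=]; apply; exact: param_cube.
Qed.

Lemma natural_measure : exists mu : {measure set (Borel_Rd R d) -> \bar R},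
  forall A, mu A = lebesgue_measure (param @^-1` A `&` `[0, 1[%classic).
Proof.
by exists (measure_function_pushforward__canonical__measure_function_Measure
  (mrestr lebesgue_measure (@measurable_itv R `[0, 1[)) measurable_param).
Qed.

Section natural_measure_bounds.
Variable mu : {measure set (Borel_Rd R d) -> \bar R}.
Hypothesis muE : forall A, mu A = lebesgue_measure (param @^-1` A `&` `[0, 1[%classic).

Lemma measurable_open (A : set 'rV[R]_d) : open A -> measurable (A : set (Borel_Rd R d)).
Proof. by move=> oA; apply: sub_sigma_algebra. Qed.

Lemma measurable_closed (A : set 'rV[R]_d) : closed A -> measurable (A : set (Borel_Rd R d)).
Proof.
move=> cA; rewrite -(setCK A); apply: measurableC; apply: measurable_open.
exact: closed_openC.
Qed.

Lemma measurable_preimage (A : set 'rV[R]_d) : measurable (A : set (Borel_Rd R d)) ->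
  measurable (param @^-1` A `&` `[0, 1[%classic : set (measurableTypeR R)).
Proof.
move=> mA; apply: measurableI; last exact: measurable_itv.
by rewrite -[X in measurable X]setTI; apply: measurable_param.
Qed.

Lemma mu_cube_ge k J (A : set 'rV[R]_d) : measurable (A : set (Borel_Rd R d)) ->
  (J < M ^ k)%N -> cube (node k J) `<=` A -> ((M%:R ^- k)%:E <= mu A)%E.
Proof.
move=> mA JM JA; rewrite muE -(lebesgue_bin k J); apply: le_measure.
- by rewrite inE; exact: measurable_itv.
- by rewrite inE; exact: measurable_preimage.
move=> x xJ; split; last exact: bin_sub xJ.
by apply: JA; rewrite -(digits_of_bin xJ); exact: param_cube.
Qed.

Lemma mu_le1 (A : set 'rV[R]_d) : measurable (A : set (Borel_Rd R d)) -> (mu A <= 1)%E.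
Proof.
move=> mA; rewrite muE.
have -> : 1%E = lebesgue_measure (`[0, 1[%classic : set R).
  by rewrite lebesgue_measure_itv/= lte_fin ltr01 sube0.
apply: le_measure; rewrite ?inE; [exact: measurable_preimage|exact: measurable_itv|].
by move=> x [].
Qed.

Lemma mu_moran : mu moran = 1%E.
Proof.
rewrite muE (_ : _ `&` _ = `[0, 1[%classic).
  by rewrite lebesgue_measure_itv/= lte_fin ltr01 sube0.
apply/seteqP; split => x; first by move=> [].
move=> x01; split => //; apply: param_moran.
by move: x01; rewrite /= in_itv.
Qed.

Lemma moran_support : moran = msupport mu.
Proof.
apply/seteqP; split => x.
  move=> xD U oU Ux; have [k kU] := nbhs_node oU Ux.
  have [J JM xJ] := xD k I.
  apply: lt_le_trans (mu_cube_ge (measurable_open oU) JM (kU J xJ)).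
  by rewrite lte_fin invr_gt0.
move=> xS; apply: contrapT => xD.
have oC : open (~` moran) by apply: closed_openC; exact: moran_closed.
have := xS _ oC xD; rewrite muE (_ : _ `&` _ = set0) ?measure0 ?ltxx//.
rewrite -subset0 => y [/= yD y01]; apply: yD; apply: param_moran.
by move: y01; rewrite /= in_itv.
Qed.

(* The cubes of generation k sit on the grid of mesh sd k, so a ball of radius at most sd k
   around a point of the unit cube meets at most three of them in each coordinate. *)
Lemma card_cubes_meeting k (x : 'rV[R]_d) r : (forall t, 0 <= x ord0 t) -> r <= sd k ->
  (#|[pred J : 'I_(M ^ k) | `[< exists2 y, cube (node k J) y & eball x r y >]]| <= 3 ^ d)%N.
Proof.
move=> x0 rk; set A := [pred J : 'I_(M ^ k) | _].
pose X t := Num.truncn (x ord0 t / sd k).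
(* For cubes meeting the ball, [close] shows that the truncated difference is exact and at most 2;
   it determines [idx], hence the node. *)
pose f (J : 'I_(M ^ k)) : {ffun 'I_d -> 'I_3} :=
  [ffun t => inord ((idx (node k J) t).+1 - X t)%N].
have close (J : 'I_(M ^ k)) t : J \in A ->
    (X t <= (idx (node k J) t).+1 /\ idx (node k J) t <= (X t).+1)%N.
  move=> /asboolP[y yJ xy]; have s0 := sd_gt0 k.
  have := yJ t; rewrite cornerE// side_node => /andP[h1 h2].
  have := le_lt_trans (edist_coord x y t) (lt_le_trans xy rk).
  rewrite ltr_norml => /andP[h3 h4].
  have xs0 : 0 <= x ord0 t / sd k by rewrite divr_ge0// ltW.
  have /andP[] := truncn_itv xs0; rewrite -/(X t) ler_pdivlMr// ltr_pdivrMr//.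
  move: h1 h2; set i := idx _ _; set s := sd k in s0 h3 h4 *; move=> h1 h2 h5 h6.
  rewrite -natr1 in h6; split.
    rewrite -ltnS -(ltr_nat R) -2!natr1 -(ltr_pM2r s0); lra.
  rewrite -ltnS -(ltr_nat R) -2!natr1 -(ltr_pM2r s0); lra.
have <- : #|{ffun 'I_d -> 'I_3}| = (3 ^ d)%N by rewrite card_ffun !card_ord.
apply: (@leq_card_in _ _ f) => J J' JA JA' e; apply: val_inj.
apply: (node_inj (ltn_ord J) (ltn_ord J')); apply: (@idx_inj b d b2); first by rewrite !size_node.
move=> t; have : val (f J t) = val (f J' t) by rewrite e.
have [h1 h2] := close J t JA; have [h3 h4] := close J' t JA'.
rewrite !ffunE /= !inordK ?ltnS ?leq_subLR ?addn2 ?ltnS// => /eqP.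
by rewrite -(eqn_add2r (X t)) !subnK// => /eqP[].
Qed.

(** The preimage of the ball is covered by the bins whose cubes meet it, at most [3 ^ d] intervals
    of length [M ^- k]. *)
Lemma mu_ball_le k (x : 'rV[R]_d) r : (forall t, 0 <= x ord0 t) -> r <= sd k ->
  (mu (eball x r) <= ((3 ^ d)%:R * M%:R ^- k)%:E)%E.
Proof.
move=> x0 rk; set A := [pred J : 'I_(M ^ k) | `[< exists2 y, cube (node k J) y & eball x r y >]].
pose F j := if `[< exists2 y, cube (node k j) y & eball x r y >] then bin k j else set0.
have mF j : measurable (F j : set (measurableTypeR R)).
  by rewrite /F; case: ifP => // _; exact: measurable_itv.
rewrite muE; apply: (@le_trans _ _ (lebesgue_measure (\big[setU/set0]_(j < M ^ k) F j))).
  apply: le_measure; rewrite ?inE.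
  - by apply: measurable_preimage; apply: measurable_open; exact: eball_open.
  - by apply: bigsetU_measurable => j _.
  move=> z [/= xz z01]; rewrite -bigcup_mkord; exists (digits z k) => /=.
    by apply: coherent_bound (digits_coherent z) _; apply: digits0; rewrite in_itv in z01.
  rewrite /F; case: asboolP => [_|[]].
    by apply: bin_digits; move: z01; rewrite in_itv => /andP[].
  by exists (param z) => //; exact: param_cube.
apply: le_trans; first by apply: Boole_inequality => j _; exact: mF.
rewrite (eq_bigr (fun j : 'I_(M ^ k) => if j \in A then (M%:R ^- k)%:E else 0%E)); last first.
  move=> j _; rewrite /F /A inE; case: ifP => _; [exact: lebesgue_bin|exact: measure0].
rewrite -big_mkcond/= sumEFin lee_fin sumr_const -[leLHS]mulr_natl.
by rewrite ler_wpM2r ?ler_nat ?card_cubes_meeting// ltW// invr_gt0.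
Qed.

End natural_measure_bounds.

(** * The dimension and Ahlfors regularity *)

Definition delta : R := ln M%:R / (N%:R * ln b%:R).

Let lnb0 : 0 < ln b%:R :> R. Proof. by rewrite ln_gt0// ltr1n. Qed.

Lemma delta_gt0 : (1 < M)%N -> 0 < delta.
Proof. by move=> M1; rewrite divr_gt0 ?mulr_gt0 ?ln_gt0 ?ltr1n ?ltr0n. Qed.

(** [delta] solves [(b ^ N) ^ delta = M], so each generation divides this power of the side by
    [M]. *)
Lemma sd_powR k : sd k `^ delta = sd 0 `^ delta * M%:R ^- k.
Proof.
elim: k => [|k IH]; first by rewrite expr0 invr1 mulr1.
have bN : (b%:R ^+ N : R) `^ delta = M%:R.
  rewrite /powR expf_eq0 (gt_eqF b0) andbF lnXn// -(mulr_natl (ln _)).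
  rewrite /delta mulfVK; first by rewrite lnK ?posrE ?ltr0n.
  by rewrite mulf_neq0 ?lt0r_neq0 ?ltr0n.
have M0R : M%:R != 0 :> R by rewrite pnatr_eq0 -lt0n.
apply: (mulfI M0R); rewrite -{1}bN -powRM ?exprn_ge0 ?(ltW (sd_gt0 _))//.
by rewrite -sdS IH exprS invfM mulrCA mulVKf.
Qed.

(** [3 ^ d] counts the cubes a ball meets, and [M] pays for passing from [sd k] to [sd k.+1], the
    first side below the radius. *)
Let C2 : R := (3 ^ d)%:R * M%:R / sd 0 `^ delta.

Let sd0 : 0 < sd 0 `^ delta. Proof. by rewrite powR_gt0// sd_gt0. Qed.

Lemma C2_gt0 : 0 < C2.
Proof. by rewrite /C2 divr_gt0// mulr_gt0// ltr0n// expn_gt0. Qed.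

Lemma moran_ge0 x t : moran x -> 0 <= x ord0 t.
Proof.
move=> /(_ 0%N I)[J _ /(_ t)/andP[h _]]; apply: le_trans h.
by have [] := @corner_bounds R b d b2 (node 0 J) t.
Qed.

Lemma mu_ball_upper (mu : {measure set (Borel_Rd R d) -> \bar R}) x r :
  (forall A, mu A = lebesgue_measure (param @^-1` A `&` `[0, 1[%classic)) ->
  (1 < M)%N -> moran x -> 0 < r -> (mu (eball x r) <= (C2 * r `^ delta)%:E)%E.
Proof.
move=> muE M1 xD r0; have dl0 := ltW (delta_gt0 M1).
case: (ex_minnP (sd_lt r0)) => -[|k] h1 h2.
  apply: (@le_trans _ _ 1%E).
    by apply: (mu_le1 muE); apply: measurable_open; exact: eball_open.
  rewrite lee_fin /C2 mulrAC ler_pdivlMr// mul1r.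
  have h : sd 0 `^ delta <= r `^ delta.
    by apply: ge0_ler_powR => //; rewrite ?nnegrE ?(ltW (sd_gt0 _)) ?(ltW r0) ?(ltW h1).
  by rewrite (le_trans h)// ler_peMl ?powR_ge0// -natrM ler1n muln_gt0 expn_gt0.
have rk : r <= sd k by rewrite leNgt; apply/negP => /h2; rewrite ltnn.
apply: le_trans (mu_ball_le muE (fun t => moran_ge0 t xD) rk) _.
rewrite lee_fin /C2 -!mulrA ler_wpM2l//.
have -> : M%:R ^- k = sd k `^ delta / sd 0 `^ delta :> R.
  by rewrite (sd_powR k) mulrAC divff ?mul1r// lt0r_neq0.
have -> : sd k `^ delta = M%:R * sd k.+1 `^ delta.
  rewrite (sd_powR k) (sd_powR k.+1) exprS invfM mulrCA mulVKf//.
  by rewrite pnatr_eq0 -lt0n.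
rewrite -mulrA ler_wpM2l// mulrC ler_wpM2l ?invr_ge0 ?powR_ge0//.
by apply: ge0_ler_powR => //; rewrite ?nnegrE ?(ltW (sd_gt0 _)) ?(ltW r0) ?(ltW h1).
Qed.

Lemma moran_Ahlfors : (0 < d)%N -> (1 < M)%N -> Ahlfors_regular moran.
Proof.
move=> d0 M1; have [mu muE] := natural_measure; have dl0 := delta_gt0 M1.
have dR : 0 < d%:R :> R by rewrite ltr0n.
have bN0 : 0 < b%:R ^+ N :> R by rewrite exprn_gt0.
have K0 : 0 < d%:R * b%:R ^+ N :> R by rewrite mulr_gt0.
(* The least [k] with [d sd k < r] gives a cube inside the ball, and [r <= d b ^ N sd k] by
   minimality; for [k = 0], [r < 1 <= d b ^ N] is used instead. *)
exists mu, delta, ((d%:R * b%:R ^+ N) `^ delta)^-1, C2.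
do 2![split; first by rewrite // invr_gt0 powR_gt0].
split; first exact: C2_gt0.
split; first exact: moran_support.
move=> r r0 r1 x xD; split; last exact: mu_ball_upper.
have ex_k : exists k, d%:R * sd k < r.
  have [k kE] := sd_lt (divr_gt0 r0 dR); exists k.
  by rewrite mulrC -ltr_pdivlMr.
have [k kr kb] : exists2 k, d%:R * sd k < r &
    ((d%:R * b%:R ^+ N) `^ delta)^-1 * r `^ delta <= M%:R ^- k.
  case: (ex_minnP ex_k) => -[|k] h1 h2.
    exists 0%N => //; rewrite expr0 invr1 ler_pdivrMl ?powR_gt0// mulr1.
    apply: ge0_ler_powR; rewrite ?nnegrE ?ltW//.
    apply: lt_le_trans r1 _; rewrite -natrX -natrM ler1n muln_gt0 d0 expn_gt0.
    by rewrite (leq_trans _ b2).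
  exists k.+1 => //; rewrite ler_pdivrMl ?powR_gt0//.
  have rk : r <= d%:R * b%:R ^+ N * sd k.+1.
    by rewrite -mulrA -sdS leNgt; apply/negP => /h2; rewrite ltnn.
  apply: (@le_trans _ _ ((d%:R * b%:R ^+ N * sd k.+1) `^ delta)).
    apply: ge0_ler_powR; rewrite ?nnegrE ?(ltW dl0) ?(ltW r0)//.
    by rewrite mulr_ge0 ?(ltW K0) ?(ltW (sd_gt0 _)).
  rewrite powRM ?(ltW K0) ?(ltW (sd_gt0 _))// ler_wpM2l ?powR_ge0//.
  rewrite (sd_powR k.+1) ler_piMl ?invr_ge0 ?exprn_ge0//.
  rewrite -(powRr0 (sd 0)); apply: ger_powR; last exact: ltW.
  by rewrite sd_gt0 sd_le1.
have [J JM xJ] := xD k I.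
apply: (@le_trans _ _ (M%:R ^- k)%:E); first by rewrite lee_fin.
apply: (mu_cube_ge muE _ JM); first by apply: measurable_open; exact: eball_open.
move=> y yJ; apply: le_lt_trans kr; rewrite -(side_node k J).
exact: cube_edist.
Qed.

(** * Hausdorff dimension *)

Lemma ediam_ub (U : set 'rV[R]_d) e x y :
  (forall x y, U x -> U y -> edist x y <= e) -> U x -> U y -> edist x y <= ediam U.
Proof.
move=> Ue Ux Uy; apply: ub_le_sup; last by exists x => //; exists y.
by exists e => _ [z Uz [w Uw <-]]; exact: Ue.
Qed.

Lemma ediam_le (U : set 'rV[R]_d) e x :
  (forall x y, U x -> U y -> edist x y <= e) -> U x -> ediam U <= e.
Proof.
move=> Ue Ux; apply: ge_sup; first by exists (edist x x), x => //; exists x.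
by move=> _ [z Uz [w Uw <-]]; exact: Ue.
Qed.

Lemma diam_pow_ge0 (U : set 'rV[R]_d) s : 0 <= diam_pow U s.
Proof. by rewrite /diam_pow; case: ifP => // _; exact: powR_ge0. Qed.

Lemma edist_le0_eq (x y : 'rV[R]_d) : edist x y <= 0 -> y = x.
Proof.
move=> h; apply/rowP => t; apply/eqP; rewrite eq_sym -subr_eq0 -normr_le0.
exact: le_trans (edist_coord x y t) h.
Qed.

(** Covering sets are arbitrary, so one that meets [moran] is enlarged to an open ball of twice its
    diameter around a point of [moran], or replaced by that point if the diameter is 0. As diameters
    are at most 1 and [s < delta], the power [delta] is bounded by the power [s]. *)
Lemma mass_bound (mu : {measure set (Borel_Rd R d) -> \bar R}) (U : set 'rV[R]_d) s :
  (forall A, mu A = lebesgue_measure (param @^-1` A `&` `[0, 1[%classic)) ->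
  (1 < M)%N -> 0 <= s -> s < delta ->
  (forall x y, U x -> U y -> edist x y <= 1) ->
  exists V : set 'rV[R]_d, [/\ measurable (V : set (Borel_Rd R d)), U `&` moran `<=` V &
    (mu V <= (C2 * 2 `^ delta * diam_pow U s)%:E)%E].
Proof.
move=> muE M1 s0 sd U1; have dl0 := delta_gt0 M1; have c20 := C2_gt0.
have K0 : 0 < C2 * 2 `^ delta by rewrite mulr_gt0// powR_gt0.
have [[x [Ux xD]]|H] := pselect (exists x, U x /\ moran x); last first.
  exists set0; rewrite measure0 lee_fin mulr_ge0 ?diam_pow_ge0 ?(ltW K0)//; split => //.
  by move=> x ?; apply: H; exists x.
have Un0 : U <> set0 by move=> U0; rewrite U0 in Ux.
have -> : diam_pow U s = ediam U `^ s by rewrite /diam_pow; case: asboolP.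
have e0 : 0 <= ediam U := le_trans (edist_ge0 x x) (ediam_ub U1 Ux Ux).
have [e_gt0|e_le0] := ltP 0 (ediam U).
  exists (eball x (2 * ediam U)); split.
  - by apply: measurable_open; exact: eball_open.
  - move=> y [Uy _]; apply: le_lt_trans (ediam_ub U1 Ux Uy) _.
    by rewrite ltr_pMl// ltr1n.
  apply: le_trans (mu_ball_upper muE M1 xD _) _; first by rewrite mulr_gt0.
  rewrite lee_fin powRM// -mulrA ler_wpM2l ?(ltW c20)// ler_wpM2l ?powR_ge0//.
  by apply: ger_powR; rewrite ?e_gt0 ?(ltW sd)//= (ediam_le U1 Ux).
have mx : measurable ([set x] : set (Borel_Rd R d)).
  apply: measurable_closed; rewrite (_ : [set x] = \bigcap_(t : 'I_d)
    ((fun y : 'rV[R]_d => y ord0 t) @^-1` [set x ord0 t])).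
    apply: closed_bigI => t _; apply: closed_comp; last exact: closed_eq.
    by move=> y _; exact: coord_continuous.
  apply/seteqP; split => [y -> //|y /= H].
  by apply/rowP => t; exact: H.
exists [set x]; split => //.
  by move=> y [Uy _]; apply: edist_le0_eq; apply: le_trans e_le0; exact: ediam_ub U1 Ux Uy.
(* The point has mass 0 because small balls around it have small mass. *)
have small r : 0 < r -> (mu [set x] <= (C2 * r `^ delta)%:E)%E.
  move=> r0; apply: le_trans (mu_ball_upper muE M1 xD r0).
  apply: le_measure; rewrite ?inE//; first by apply: measurable_open; exact: eball_open.
  move=> _ ->; rewrite /eball /= /Defs.edist big1 ?sqrtr0// => t _.
  by rewrite subrr expr0n.
apply: (@le_trans _ _ 0%E); last by rewrite lee_fin mulr_ge0 ?(ltW K0) ?powR_ge0.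
apply/lee_addgt0Pr => e' e'0; rewrite add0e.
apply: le_trans (small ((e' / C2) `^ delta^-1) _) _; first by rewrite powR_gt0// divr_gt0.
rewrite lee_fin -powRrM mulVf ?lt0r_neq0// powRr1.
  by rewrite mulrC divfK// lt0r_neq0.
by apply: divr_ge0; exact: ltW.
Qed.

(** The mass distribution principle: summing [mass_bound] over a cover by sets of diameter at most 1
    must yield at least the total mass 1. *)
Lemma hausdorff_measure_neq0 s : (1 < M)%N -> 0 <= s -> s < delta ->
  hausdorff_measure s moran <> 0%E.
Proof.
move=> M1 s0 sd; have [mu muE] := natural_measure.
have K0 : 0 < C2 * 2 `^ delta by rewrite mulr_gt0 ?powR_gt0 ?C2_gt0.
suff h : ((C2 * 2 `^ delta)^-1%:E <= hausdorff_measure s moran)%E.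
  by move=> e; move: h; rewrite e lee_fin leNgt invr_gt0 K0.
apply: le_ereal_sup_tmp; exists (hausdorff_pre s 1 moran); first by exists 1 => //; exact: ltr01.
apply: le_ereal_inf_tmp => _ [U [Ucov U1] <-].
have /choice[V HV] (i : nat) := @mass_bound mu (U i) s muE M1 s0 sd (U1 i).
have mD : measurable (moran : set (Borel_Rd R d)).
  by apply: measurable_closed; exact: moran_closed.
have h1 : (1 <= \sum_(0 <= i <oo) ((C2 * 2 `^ delta)%:E * (diam_pow (U i) s)%:E))%E.
  rewrite -(mu_moran muE).
  apply: (@le_trans _ _ (\sum_(0 <= i <oo) mu (V i))%E); last first.
    by apply: lee_nneseries => [i _ _|i _]; [exact: measure_ge0|rewrite -EFinM; have [] := HV i].
  apply: measure_sigma_subadditive => //; first by move=> i; have [] := HV i.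
  move=> x xD; have [i _ Ux] := Ucov x xD; exists i => //.
  by have [_ + _] := HV i; apply.
rewrite nneseriesZl in h1; last by move=> i _; rewrite lee_fin diam_pow_ge0.
by rewrite -(@lee_pmul2l _ (C2 * 2 `^ delta)%:E)// -EFinM divff// lt0r_neq0.
Qed.

Lemma sum_initial_le (a : R) n K : 0 <= a ->
  \sum_(0 <= i < n) (if (i < K)%N then a else 0) <= K%:R * a.
Proof.
move=> a0; rewrite -big_mkcond/= big_mkord sumr_const -[leLHS]mulr_natl.
rewrite ler_wpM2r// ler_nat.
have inj : injective (fun x : {i : 'I_n | (i < K)%N} => Ordinal (valP x)).
  by move=> [i hi] [j hj] /(congr1 val) /= e; apply/val_inj/val_inj.
by have := leq_card _ inj; rewrite card_sig card_ord.
Qed.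

Lemma hausdorff_measure_eq0 s : (1 < M)%N -> (0 < d)%N -> delta < s ->
  hausdorff_measure s moran = 0%E.
Proof.
move=> M1 d0 ds; have dl0 := delta_gt0 M1; have s_gt0 := lt_trans dl0 ds.
have dR : 0 < d%:R :> R by rewrite ltr0n.
have pre_ge0 e : (0 <= hausdorff_pre s e moran)%E.
  apply: le_ereal_inf_tmp => _ [U _ <-].
  by apply: nneseries_ge0 => i _ _; rewrite lee_fin diam_pow_ge0.
apply/eqP; rewrite eq_le; apply/andP; split; last first.
  by apply: le_ereal_sup_tmp; exists (hausdorff_pre s 1 moran); [by exists 1 => //; exact: ltr01|].
apply: ge_ereal_sup => _ [e /= e0 <-].
apply/lee_addgt0Pr => g g0; rewrite add0e.
pose K := sd 0 `^ delta * d%:R `^ s.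
have K0 : 0 < K by rewrite mulr_gt0// powR_gt0.
(* The first bound on the side keeps the diameters at most [e]; the second makes the total
   [K sd k ^ (s - delta)] over the [M ^ k] cubes at most [g]. *)
pose h := Num.min (e / d%:R) ((g / K) `^ (s - delta)^-1).
have h0 : 0 < h by rewrite lt_min divr_gt0//= powR_gt0// divr_gt0.
have [k kh] := sd_lt h0; move: kh; rewrite lt_min => /andP[k1 k2].
have sk0 := sd_gt0 k.
have tot : (M ^ k)%:R * (d%:R * sd k) `^ s <= g.
  have -> : (M ^ k)%:R = sd 0 `^ delta / sd k `^ delta.
    rewrite (sd_powR k) invfM invrK mulrA divff ?mul1r ?natrX//.
    by rewrite lt0r_neq0.
  rewrite powRM ?(ltW dR) ?(ltW sk0)//.
  have -> : sd 0 `^ delta / sd k `^ delta * (d%:R `^ s * sd k `^ s) = K * sd k `^ (s - delta).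
    rewrite powRB; last by rewrite (gt_eqF sk0) implybT.
    by rewrite /K; ring.
  rewrite -ler_pdivlMl// mulrC.
  have -> : g / K = ((g / K) `^ (s - delta)^-1) `^ (s - delta).
    rewrite -powRrM mulVf ?powRr1 ?divr_ge0 ?ltW//.
    by rewrite lt0r_neq0// subr_gt0.
  apply: ge0_ler_powR; rewrite ?nnegrE ?(ltW sk0) ?powR_ge0 ?(ltW k2)//.
  by rewrite subr_ge0 ltW.
(* The finite cover is padded with empty sets, on which [diam_pow] is 0. *)
pose U i : set 'rV[R]_d := if (i < M ^ k)%N then cube (node k i) else set0.
apply: (@le_trans _ _ (\sum_(0 <= i <oo) (diam_pow (U i) s)%:E)%E).
  apply: ge_ereal_inf; exists (\sum_(0 <= i <oo) (diam_pow (U i) s)%:E)%E => //.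
  exists U => //; split.
    by move=> x /(_ k I)[J JM xJ]; exists J => //; rewrite /U JM.
  move=> i x y; rewrite /U; case: ifP => // _ xi yi.
  apply: le_trans (cube_edist b2 xi yi) _; rewrite side_node.
  by rewrite mulrC -ler_pdivlMr// ltW.
have bd i : diam_pow (U i) s <= if (i < M ^ k)%N then (d%:R * sd k) `^ s else 0.
  rewrite /U; case: ifP => _; last by rewrite /diam_pow asboolT.
  rewrite /diam_pow; case: asboolP => [_|Un0]; first exact: powR_ge0.
  have [x xi] : exists x : 'rV[R]_d, cube (node k i) x.
    by apply: contrapT => H; apply: Un0; apply/seteqP; split => x // xi; apply: H; exists x.
  have cd y z : cube (node k i) y -> cube (node k i) z -> edist y z <= d%:R * sd k.
    by move=> yi zi; rewrite -(side_node k i); exact: (cube_edist b2 yi zi).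
  apply: ge0_ler_powR; rewrite ?nnegrE ?(ltW s_gt0)//.
  - by apply: le_trans (edist_ge0 x x) _; exact: (ediam_ub cd xi xi).
  - by rewrite mulr_ge0// ltW.
  - exact: ediam_le cd xi.
apply: lime_le.
  by apply: is_cvg_nneseries => i _ _; rewrite lee_fin diam_pow_ge0.
apply: nearW => n; rewrite sumEFin lee_fin; apply: le_trans tot.
apply: le_trans (sum_initial_le n (M ^ k) (powR_ge0 _ _)).
by apply: ler_sum_nat.
Qed.

Lemma moran_hausdorff_dim : (1 < M)%N -> (0 < d)%N -> hausdorff_dim moran = delta%:E.
Proof.
move=> M1 d0; have dl0 := delta_gt0 M1; apply/eqP; rewrite eq_le; apply/andP; split.
  apply/lee_addgt0Pr => e e0; apply: ge_ereal_inf; exists (delta + e)%:E => //.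
  exists (delta + e) => //; split; first by rewrite addr_ge0// ltW.
  by apply: hausdorff_measure_eq0; rewrite // ltrDl.
apply: le_ereal_inf_tmp => _ [s [s0 Hs] <-]; rewrite lee_fin leNgt; apply/negP => sd.
exact: (hausdorff_measure_neq0 M1 s0 sd).
Qed.
End regular_subtree.

(** * Almost sure existence of regular subsets *)

Lemma card_Alph b d : #|Alph b d| = (b ^ d)%N.
Proof. by rewrite /Alph card_ffun !card_ord. Qed.

(** * Choice of the parameters *)

Section parameters.
Variables (R : realType) (L : finType) (p : R).
Hypotheses (p0 : 0 < p) (p1 : p < 1) (m1 : 1 < p * #|L|%:R).

(** Keeps the dimensions at most [log_b m]: with [t <= m ^ n q / 2] it yields
    [#|L| ^ 2 t <= m ^ (n + 2)]. *)
Lemma qstar_le_sqr : qstar L p <= p ^+ 2.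
Proof.
have L2 := card_letters_ge2 p0 p1 m1.
have z0 := pz_const_gt0 m1; have z1 := pz_const_le1 m1.
have pz0 : 0 <= p * pz_const L p by rewrite ltW// mulr_gt0.
have pz1 : p * pz_const L p <= 1 by rewrite mulr_ile1 ?(ltW p0) ?(ltW p1) ?(ltW z0).
have pzL0 : 0 <= (p * pz_const L p) ^+ #|L| by rewrite exprn_ge0.
have pzL1 : (p * pz_const L p) ^+ #|L| <= 1 by rewrite exprn_ile1.
apply: (@le_trans _ _ (p ^+ #|L|)).
  rewrite /qstar lerXn2r ?nnegrE ?mulr_ge0 ?(ltW p0)//.
  by rewrite ler_piMr// ltW.
by rewrite ler_wiXn2l// ltW.
Qed.

Lemma exists_parameters (b : nat) (e : R) : (1 < b)%N -> 0 < e ->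
  exists n t, [/\ (0 < t)%N, 1 <= (p * #|L|%:R) ^+ n * qstar L p,
    t%:R <= (p * #|L|%:R) ^+ n * qstar L p / 2 &
    ln (p * #|L|%:R) / ln b%:R - e < ln (#|L| * #|L| * t)%:R / (n.+2%:R * ln b%:R)
      <= ln (p * #|L|%:R) / ln b%:R].
Proof.
move=> b1 e0; have L2 := card_letters_ge2 p0 p1 m1.
have q0 : 0 < qstar L p by exact: qstar_gt0.
have qp := qstar_le_sqr; move: (qstar L p) q0 qp => q q0 qp.
have [m Em] : exists m, m = p * #|L|%:R by exists (p * #|L|%:R).
have mgt1 : 1 < m by rewrite Em.
rewrite -Em.
have m0 : 0 < m by rewrite (lt_trans _ mgt1).
have lm0 : 0 < ln m by rewrite ln_gt0.
have lb0 : 0 < ln b%:R :> R by rewrite ln_gt0// ltr1n.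
have q4 : 0 < q / 4 by rewrite divr_gt0.
(* [n > A] yields [m ^ n q >= 4], so truncation leaves [t >= m ^ n q / 4]; [n > B] makes the error
   caused by [q / 4] and the two extra generations smaller than [e]. *)
pose A := - ln (q / 4) / ln m.
pose B := (2 * ln m - ln (q / 4)) / (e * ln b%:R).
have [n An Bn] : exists2 n : nat, A < n%:R & B < n%:R.
  exists (maxn (Num.truncn A).+1 (Num.truncn B).+1).
    by apply: lt_le_trans (truncnS_gt A) _; rewrite ler_nat leq_maxl.
  by apply: lt_le_trans (truncnS_gt B) _; rewrite ler_nat leq_maxr.
have mn0 : 0 < m ^+ n by rewrite exprn_gt0.
have mnq : 4 <= m ^+ n * q.
  have : 0 < ln (m ^+ n * (q / 4)).
    rewrite lnM ?posrE// lnXn// -(mulr_natr (ln m)).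
    rewrite ltr_pdivrMr// in An.
    by move: An; rewrite (mulrC (ln m)); move: (_ * ln m) (ln _) => x y; lra.
  move=> h; have : 1 < m ^+ n * (q / 4).
    rewrite ltNge; apply/negP => /ln_le0; by rewrite leNgt h.
  by rewrite mulrA ltr_pdivlMr// mul1r => /ltW.
pose t := Num.truncn (m ^+ n * q / 2).
have mq2 : 0 <= m ^+ n * q / 2 by rewrite divr_ge0// ltW// mulr_gt0.
have /andP[t1 t2] : t%:R <= m ^+ n * q / 2 < t.+1%:R := truncn_itv mq2.
rewrite -[t.+1%:R]natr1 in t2.
have t4 : m ^+ n * (q / 4) <= t%:R.
  by rewrite mulrA; move: (m ^+ n * q) (t%:R : R) mnq t1 t2 => x y; lra.
have t0 : (0 < t)%N by rewrite -(ltr_nat R) (lt_le_trans _ t4)// mulr_gt0.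
exists n, t; split => //; first by rewrite (le_trans _ mnq)// ler1n.
have K1 : 1 <= (#|L| * #|L|)%:R :> R by rewrite ler1n muln_gt0 !(ltnW L2).
have M0 : 0 < (#|L| * #|L| * t)%:R :> R by rewrite ltr0n !muln_gt0 !(ltnW L2).
have nb0 : 0 < n.+2%:R * ln b%:R :> R by rewrite mulr_gt0.
apply/andP; split.
  rewrite ltr_pdivlMr// mulrBl mulrCA divfK ?lt0r_neq0//.
  apply: (@lt_le_trans _ _ (ln (m ^+ n * (q / 4)))); last first.
    rewrite ler_ln ?posrE ?mulr_gt0//.
    by apply: le_trans t4 _; rewrite natrM ler_peMl.
  rewrite lnM ?posrE// lnXn// -(mulr_natr (ln m)) -2!natr1.
  rewrite ltr_pdivrMr ?mulr_gt0// in Bn.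
  have : 0 < e * ln b%:R by rewrite mulr_gt0.
  move: Bn; rewrite !mulrA; set x := n%:R; set y := e * ln _; nra.
rewrite ler_pdivrMr// mulrCA divfK ?lt0r_neq0// mulrC mulr_natr -lnXn//.
rewrite ler_ln ?posrE ?exprn_gt0// natrM -addn2 exprD.
have -> : m ^+ 2 = (#|L| * #|L|)%:R * p ^+ 2 by rewrite natrM Em; ring.
rewrite mulrCA ler_wpM2l//; apply: le_trans t1 _.
rewrite -mulrA ler_wpM2l ?(ltW mn0)//; apply: le_trans qp.
by rewrite ler_piMr ?(ltW q0)//; lra.
Qed.

End parameters.

(** An index of the maximum of [u 0, ..., u j]. Reindexing by it makes the dimensions nondecreasing
    and, since they never exceed their limit, preserves the limit. *)
Fixpoint running_argmax (R : realType) (u : nat -> R) j : nat :=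
  if j is j'.+1 then if u (running_argmax u j') < u j then j else running_argmax u j' else 0.

Lemma running_argmax_homo (R : realType) (u : nat -> R) :
  {homo (fun j => u (running_argmax u j)) : i j / (i <= j)%N >-> i <= j}.
Proof.
by apply/nondecreasing_seqP => j /=; case: ifP => // /ltW.
Qed.

Lemma le_running_argmax (R : realType) (u : nat -> R) j : u j <= u (running_argmax u j).
Proof.
by case: j => //= j; case: ifP => //; rewrite ltNge => /negbFE.
Qed.

(** * Assembly of the sequence of subsets *)

Section percolation.
Variables (R : realType) (dO : measure_display) (Omega : measurableType dO).
Variables (P : probability Omega R) (b d : nat) (p : R).
Local Notation L := (Alph b d).
Variable W : seq L -> Omega -> {set L}.
Hypotheses (b2 : (2 <= b)%N) (d0 : (0 < d)%N) (p0 : 0 < p) (p1 : p < 1).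
Hypothesis m1 : 1 < p * #|L|%:R.
Hypothesis mW : forall a B, measurable [set w : Omega | W a w = B].
Hypothesis PW : forall (s : seq (seq L)) (B : seq L -> {set L}), uniq s ->
  P [set w : Omega | forall a, a \in s -> W a w = B a] =
  (\prod_(a <- s) (p ^+ #|B a| * (1 - p) ^+ #|~: B a|))%:E.

Lemma regular_subset (V : seq L -> {set L}) n t v0 :
  (0 < t)%N -> inT V v0 -> very_good V n t v0 -> exists D : set 'rV[R]_d,
  [/\ D `<=` limit_set V, hyperplane_diffuse D, Ahlfors_regular D &
    hausdorff_dim D = (ln (#|L| * #|L| * t)%:R / (n.+2%:R * ln b%:R))%:E].
Proof.
move=> t0 v0T v0g; pose good v := inT V v /\ very_good V n t v.
have L2 := card_letters_ge2 p0 p1 m1; have L0 := ltnW L2.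
have /choice[ch chP] (v : seq L) : exists s, good v ->
    [/\ uniq s, size s = (#|L| * #|L| * t)%N,
      forall u, u \in s -> size u = n.+2 /\ good (v ++ u) &
      forall c : L, exists u, [:: c, c & u] \in s].
  have [[vT vg]|nv] := pselect (good v); last by exists [::].
  have [s [us ss sP sc]] := very_good_children t0 vg; exists s => _; split => //.
  move=> u us'; have [-> uT ug] := sP u us'; split => //; split => //.
  by apply/inT_from_cat.
have /card_gt0P[c0 _] := L0.
have M1 : (1 < #|L| * #|L| * t)%N.
  by rewrite -mulnA (leq_trans L2)// leq_pmulr// muln_gt0 L0.
have gT v : good v -> inT V v by case.
have gv0 : good v0 by [].
exists (moran (#|L| * #|L| * t)%N ch v0); split.
- exact: (moran_limit_set b2 c0 (ltn0Sn n.+1) (ltnW M1) gv0 gT chP).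
- exact: (moran_diffuse R b2 c0 (ltn0Sn n.+1) (ltnW M1) gv0 chP d0).
- exact: (moran_Ahlfors R b2 c0 (ltn0Sn n.+1) (ltnW M1) gv0 chP d0 M1).
- exact: (moran_hausdorff_dim R b2 c0 (ltn0Sn n.+1) (ltnW M1) gv0 chP M1 d0).
Qed.

Lemma ae_regular_subsets : {ae P, forall w, nonextinct (fun a => W a w) ->
  exists (D : nat -> set 'rV[R]_d) (dims : nat -> R),
    (forall n, D n `<=` @limit_set R b d (fun a => W a w)) /\
    (forall n, hyperplane_diffuse (D n)) /\
    (forall n, Ahlfors_regular (D n)) /\
    (forall n, hausdorff_dim (D n) = (dims n)%:E) /\
    {homo dims : n1 n2 / (n1 <= n2)%N >-> n1 <= n2} /\
    dims @ \oo --> ln (p * #|L|%:R) / ln (b%:R)}.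
Proof.
set l := ln _ / ln _.
have e0 (j : nat) : 0 < j.+1%:R^-1 :> R by rewrite invr_gt0.
have /choice[n /choice[t nt]] := fun j => exists_parameters p0 p1 m1 b2 (e0 j).
pose u j := ln (#|L| * #|L| * t j)%:R / ((n j).+2%:R * ln b%:R) : R.
(* The parameters are chosen independently of the outcome, so one null set serves all countably many
   pairs. *)
have Hae : {ae P, forall w, forall j, nonextinct (fun a => W a w) ->
    exists v, inT (fun a => W a w) v /\ forall k, goodW (fun a => W a w) (n j) (t j) k v}.
  apply/ae_foralln => j; have [] := nt j.
  by move=> _ h1 h2 _; exact: (ae_good_vertex p0 p1 m1 mW PW h1 h2).
apply: filterS Hae => w Hw nw.
have /choice[D HD] (j : nat) : exists D : set 'rV[R]_d,
    [/\ D `<=` limit_set (fun a => W a w), hyperplane_diffuse D, Ahlfors_regular D &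
      hausdorff_dim D = (u j)%:E].
  have [v [vT vg]] := Hw j nw; have [] := nt j.
  by move=> t0 _ _ _; exact: (regular_subset t0 vT vg).
exists (fun j => D (running_argmax u j)), (fun j => u (running_argmax u j)).
do 4![split; first by move=> j; have [] := HD (running_argmax u j)].
split; first exact: running_argmax_homo.
have ul j : l - j.+1%:R^-1 < u j <= l.
  by have [] := nt j.
apply: (@squeeze_cvgr _ _ _ _ (fun j => l - j.+1%:R^-1) (fun=> l)).
- apply: nearW => j; have /andP[h _] := ul j; have /andP[_ h'] := ul (running_argmax u j).
  by rewrite h' andbT (le_trans (ltW h))// le_running_argmax.
- rewrite -[X in _ --> X]subr0; apply: cvgB; first exact: cvg_cst.
  exact: cvg_harmonic.
- exact: cvg_cst.
Qed.

End percolation.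

Theorem theorem4p1 (R : realType) (dO : measure_display) (Omega : measurableType dO)
  (P : probability Omega R) (b d : nat) (p : R)
  (W : seq (Alph b d) -> Omega -> {set Alph b d}) :
  (2 <= b)%N -> 0 < p -> p < 1 ->
  (* supercritical: m = p b^d > 1 *)
  1 < p * (b ^ d)%:R ->
  (* the offspring sets W_a are random (measurable) *)
  (forall (a : seq (Alph b d)) (B : {set Alph b d}),
      measurable [set w : Omega | W a w = B]) ->
  (* the W_a are independent, P(W_a = B) = p^|B| (1-p)^|Lambda \ B| *)
  (forall (s : seq (seq (Alph b d))) (B : seq (Alph b d) -> {set Alph b d}),
      uniq s ->
      P [set w : Omega | forall a, a \in s -> W a w = B a] =
      (\prod_(a <- s) (p ^+ #|B a| * (1 - p) ^+ #|~: B a|))%:E) ->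
  {ae P, forall w : Omega,
     nonextinct (fun a => W a w) ->
     exists (D : nat -> set 'rV[R]_d) (dims : nat -> R),
       (forall n, D n `<=` @limit_set R b d (fun a => W a w)) /\
       (forall n, hyperplane_diffuse (D n)) /\
       (forall n, Ahlfors_regular (D n)) /\
       (forall n, hausdorff_dim (D n) = (dims n)%:E) /\
       {homo dims : n1 n2 / (n1 <= n2)%N >-> n1 <= n2} /\
       dims @ \oo --> ln (p * (b ^ d)%:R) / ln (b%:R)}.
Proof.
move=> b2 p0 p1 m1 mW PW.
have d0 : (0 < d)%N.
  (* In dimension 0 supercriticality would read [p > 1]. *)
  by case: d W m1 mW PW => // W' m1; rewrite expn0 mulr1 ltNge (ltW p1) in m1.
rewrite -card_Alph in m1 *.
exact: ae_regular_subsets.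
Qed.
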